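(* Let $R\in(0,\infty)$, $s_+>0$, and let $F:\mathbb{R}\to\mathbb{R}$ be a $C^1$ function such that $F(0)=F(s_+)=0$, $F'(s_+)>0$, $F(t)<0$ for $t\in(0,s_+)$, and $F(t)\ge0$ for $t\in(s_+,+\infty)$. Assume moreover that for some $\varkappa>0$, $0\le\lambda<4$ and $C>0$ we have $F(t)=\varkappa t^4+\mathring F(t)$ with $$|\mathring F(t)|\le C(1+|t|^\lambda)\quad\text{for all }t\in\mathbb{R}.$$ Then, besides its unique non-negative solution, the problem $$u''(r)+\frac2r u'(r)-\frac{6}{r^2}u(r)=F(u(r))\ \text{ in }(0,R),\qquad u(0)=0,\quad u(R)=s_+$$ admits a sign-changing solution.
   Context: A solution is a function $u\in C^2(0,R)$ satisfying the ODE pointwise, with $\lim_{r\to0^+}u(r)=0$ and $\lim_{r\to R^-}u(r)=s_+$. Under the first set of hypotheses on $F$ the problem has exactly one non-negative solution. *)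

(* Defs.v *)
From Stdlib Require Import Reals.
From Coquelicot Require Import Coquelicot.
Open Scope R_scope.

(* [D] is meant to be open.  All orders [j <= k] are listed because
   [ex_derive_n f k x] alone only says that [Derive_n f (k-1)] is
   differentiable at [x], where [Derive_n f (k-1)] may take default values. *)
Definition class_C (k : nat) (D : R -> Prop) (f : R -> R) : Prop :=
  forall x, D x ->
    (forall j, (j <= k)%nat -> ex_derive_n f j x) /\
    continuous (Derive_n f k) x.

(* The real power x^y for x >= 0, with 0^0 = 1 and 0^y = 0 for y <> 0
   ([Rpower 0 y] is 1 for every y, since [ln 0 = 0]). *)
Definition real_pow (x y : R) : R :=
  if Req_dec_T x 0 then (if Req_dec_T y 0 then 1 else 0) else Rpower x y.

(* The unknown is a function on (0, L); only its values there are used. *)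
Definition is_solution (F : R -> R) (L s : R) (u : R -> R) : Prop :=
  class_C 2 (fun r => 0 < r < L) u /\
  (forall r, 0 < r < L ->
     Derive_n u 2 r + 2 / r * Derive u r - 6 / r ^ 2 * u r = F (u r)) /\
  filterlim u (at_right 0) (locally 0) /\
  filterlim u (at_left L) (locally s).

Definition nonneg_on (L : R) (u : R -> R) : Prop :=
  forall r, 0 < r < L -> 0 <= u r.

Definition sign_changing_on (L : R) (u : R -> R) : Prop :=
  (exists r, 0 < r < L /\ u r < 0) /\ (exists r, 0 < r < L /\ 0 < u r).

(* Main.v *)
Require Import Defs.
From Stdlib Require Import Reals Lra Lia Psatz Classical.
From Coquelicot Require Import Coquelicot.
Open Scope R_scope.

(** Writing [u = r^2 V] turns the equation into [(r^6 V')' = r^4 F(r^2 V)], which can be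
    solved from [V 0 = a], [V' 0 = 0] for every slope [a]; both existence claims follow
    from the intermediate value theorem in [a], after truncating [F] outside [[lo, s]].
    The truncation above [s] is harmless by the maximum principle.

    Non-negative solution: [lo = 0] and [a > 0].  Then [V] decreases, and the bound
    [|F(r^2 V)| = O(r sqrt a)] gives [V L >= a - O(sqrt a)].

    Uniqueness: since [F < 0] on [(0, s)], [u (lam r)] is a strict supersolution for
    [lam > 1]; slide [lam] down to 1 from a large value.

    Sign-changing solution: [lo = - M] and [a < 0].  With [z = - V], [q = r z'],
    [theta = q / z], [k = kappa r^8 z^3], a Pohozaev (anti-damping) quantity stays positive
    because the power 4 is subcritical, i.e.
    [k > - (5/2 theta^2 + 13 theta + 4/3)].  This forces [theta] down to [- 76/15 < - 5] within
    a bounded factor of the natural scale [kappa |a|^3 r^8 = 32]; from there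
    the singular mode [r^-5] carries [V] through zero with so large an
    amplitude that [u > s] soon after.  Hence [u L] crosses the value [s] as [a] runs from 0 to
    a very negative slope.  An energy estimate bounds these solutions below independently
    of [M]. *)

(** * Monotonicity, barriers and the maximum principle *)

(** The operator [V'' + 6 V' / r] is the radial Laplacian in dimension 7. For the pure power,
    [z'' + 6 z' / r = - kappa r^6 z^4], whose critical exponent is 21/5; this is why 4 is
    subcritical. With [y = r^(8/3) z] and [t = ln r] it reads
    [y'' - y' / 3 - 56/9 y + kappa y^4 = 0], and [- y' / 3] is the anti-damping. The Pohozaev
    quantity [J] is five times the energy [y'^2 / 2 - 28/9 y^2 + kappa y^5 / 5], minus [y y' / 3];
    the correction leaves [y'^2 / 2 + 28/9 y^2] in [J' - J / 3], a margin that absorbs the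
    lower-order part of [F]. The order of choices matters: the truncation level [M] must exceed the
    depth of the steep solution, hence depends on its slope, so the slope is fixed first, by
    estimates valid for every later truncation. Working with [V] also lets the sliding start: [V]
    stays positive at the origin, where [u] vanishes. *)

Lemma is_derive_cont (g : R -> R) x l : is_derive g x l -> continuous g x.
Proof. intros H; apply (ex_derive_continuous (V := R_NormedModule)); now exists l. Qed.

Lemma mean_value (g dg : R -> R) a b :
  a <= b -> (forall x, a <= x <= b -> is_derive g x (dg x)) ->
  exists c, a <= c <= b /\ g b - g a = dg c * (b - a).
Proof.
intros hab hd.
destruct (MVT_gen g a b dg) as [c [hc e]].
- rewrite Rmin_left, Rmax_right by lra; intros x hx; apply hd; lra.
- rewrite Rmin_left, Rmax_right by lra; intros x hx.
  apply continuity_pt_filterlim, (is_derive_cont _ _ (dg x)), hd, hx.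
- rewrite Rmin_left, Rmax_right in hc by lra; now exists c.
Qed.

Lemma deriv_ge0_incr (g dg : R -> R) a b :
  a <= b -> (forall x, a <= x <= b -> is_derive g x (dg x)) ->
  (forall x, a <= x <= b -> 0 <= dg x) -> g a <= g b.
Proof.
intros hab hd h0; destruct (mean_value g dg a b hab hd) as [c [hc e]].
specialize (h0 c hc); nra.
Qed.

Lemma deriv_le0_decr (g dg : R -> R) a b :
  a <= b -> (forall x, a <= x <= b -> is_derive g x (dg x)) ->
  (forall x, a <= x <= b -> dg x <= 0) -> g b <= g a.
Proof.
intros hab hd h0; destruct (mean_value g dg a b hab hd) as [c [hc e]].
specialize (h0 c hc); nra.
Qed.

Lemma continuous_pos_near (g : R -> R) x :
  continuous g x -> 0 < g x ->
  exists d, 0 < d /\ forall y, Rabs (y - x) < d -> 0 < g y.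
Proof.
intros hc hg.
destruct (proj1 (filterlim_locally g (g x)) hc (mkposreal _ hg)) as [d hd].
exists d; split; [apply cond_pos|]; intros y hy.
specialize (hd y hy); apply Rabs_def2 in hd; simpl in hd.
unfold minus, plus, opp in hd; simpl in hd; lra.
Qed.

Lemma first_zero (g : R -> R) a b :
  a <= b -> (forall x, a <= x <= b -> continuous g x) -> 0 < g a -> g b <= 0 ->
  exists c, a < c <= b /\ g c = 0 /\ forall x, a <= x < c -> 0 < g x.
Proof.
intros hab hc ha hb.
set (E := fun x => a <= x <= b /\ forall y, a <= y <= x -> 0 < g y).
assert (Ea : E a) by (split; [lra|]; intros y hy; now replace y with a by lra).
destruct (completeness E) as [c [c1 c2]].
{ exists b; intros x [hx _]; lra. }
{ now exists a. }
assert (hac : a <= c) by now apply c1.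
assert (hcb : c <= b) by (apply c2; intros x [hx _]; lra).
assert (hbelow : forall x, a <= x < c -> 0 < g x).
{ intros x hx; apply NNPP; intros hn.
  assert (c <= x); [|lra].
  apply c2; intros y [hy1 hy2]; apply Rnot_lt_le; intros hxy.
  apply hn, hy2; lra. }
assert (gc : g c = 0).
{ destruct (Rtotal_order (g c) 0) as [h|[h|h]]; [|assumption|].
  - destruct (continuous_pos_near (fun x => - g x) c) as [d [hd h2]].
    + apply (continuous_opp (V := R_NormedModule)), hc; lra.
    + lra.
    + destruct (Req_dec c a) as [->|hn]; [lra|].
      set (x := Rmax a (c - d / 2)).
      assert (hx : a <= x < c) by (unfold x, Rmax; destruct (Rle_dec _ _); lra).
      assert (0 < - g x); [|specialize (hbelow x hx); lra].
      apply h2; unfold x in *; apply Rabs_def1;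
        unfold Rmax in *; destruct (Rle_dec _ _); lra.
  - exfalso; destruct (continuous_pos_near g c) as [d [hd h2]]; [apply hc; lra|lra|].
    destruct (Req_dec c b) as [->|hn]; [lra|].
    set (x := Rmin b (c + d / 2)).
    assert (hx : c < x <= b) by (unfold x, Rmin; destruct (Rle_dec _ _); lra).
    assert (x <= c); [|lra].
    apply c1; split; [lra|]; intros y hy.
    destruct (Rlt_le_dec y c) as [h3|h3]; [apply hbelow; lra|].
    apply h2; apply Rabs_def1; unfold x, Rmin in hy; destruct (Rle_dec _ _); lra. }
exists c; repeat split; [|lra|assumption|assumption].
destruct (Req_dec c a) as [e|]; [rewrite e in gc; lra|lra].
Qed.

Lemma is_derive_left_le0 (g : R -> R) x l a :
  a < x -> is_derive g x l -> (forall y, a <= y < x -> g x <= g y) -> l <= 0.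
Proof.
intros hax hd h; apply Rnot_lt_le; intros hl.
apply is_derive_Reals in hd.
destruct (hd (l / 2)) as [d hd']; [lra|].
set (t := - Rmin (d / 2) (x - a)).
assert (hdp := cond_pos d).
assert (ht : - d < t < 0 /\ a <= x + t).
{ unfold t, Rmin; destruct (Rle_dec _ _); lra. }
specialize (hd' t ltac:(lra) ltac:(apply Rabs_def1; lra)).
apply Rabs_def2 in hd'.
assert (g x <= g (x + t)) by (apply h; lra).
assert ((g (x + t) - g x) / t <= 0); [|lra].
unfold Rdiv; assert (/ t < 0) by (apply Rinv_lt_0_compat; lra); nra.
Qed.

(** At a first zero the left difference quotients are nonpositive, which contradicts a positive
    derivative. The differential inequality is thus checked only on the zero set of [g], where an
    algebraic identity is available. *)
Lemma barrier (g dg : R -> R) a b :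
  (forall x, a <= x <= b -> is_derive g x (dg x)) -> 0 < g a ->
  (forall x, a < x <= b -> g x = 0 -> (forall y, a <= y < x -> 0 < g y) -> 0 < dg x) ->
  forall x, a <= x <= b -> 0 < g x.
Proof.
intros hd ha hb x hx; apply Rnot_le_lt; intros hle.
destruct (first_zero g a x) as [c [hc [gc hlt]]]; try lra; auto.
{ intros y hy; apply (is_derive_cont _ _ (dg y)), hd; lra. }
assert (dg c <= 0).
{ apply (is_derive_left_le0 g c (dg c) a); [lra|apply hd; lra|].
  intros y hy; rewrite gc; apply Rlt_le, hlt, hy. }
specialize (hb c ltac:(lra) gc hlt); lra.
Qed.

Lemma interior_max_second_derivative (g dg : R -> R) x l a b :
  a < x < b -> (forall y, a < y < b -> is_derive g y (dg y)) -> is_derive dg x l ->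
  (forall y, a < y < b -> g y <= g x) -> dg x = 0 /\ l <= 0.
Proof.
intros hx hd hd2 hmax.
assert (hl : 0 <= dg x).
{ apply Ropp_le_cancel; rewrite Ropp_0.
  apply (is_derive_left_le0 (fun y => - g y) x (- dg x) ((a + x) / 2)); [lra| |].
  - apply (is_derive_opp (V := R_NormedModule)), hd; lra.
  - intros y hy; specialize (hmax y); lra. }
(* [is_derive_left_le0] looks to the left only; the reflection [y -> - y] covers the right. *)
assert (hr : dg x <= 0).
{ apply (is_derive_left_le0 (fun y => - g (- y)) (- x) _ (- (x + b) / 2)); [lra| |].
  - replace (dg x) with (- (- 1 * dg x)) by ring.
    apply (is_derive_opp (V := R_NormedModule) (fun y => g (- y))).
    apply (is_derive_comp (V := R_NormedModule) g Ropp).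
    + rewrite Ropp_involutive; apply hd; lra.
    + auto_derive; trivial.
  - intros y hy; rewrite Ropp_involutive; specialize (hmax (- y)); lra. }
assert (h0 : dg x = 0) by lra; split; [exact h0|].
apply Rnot_lt_le; intros hl0.
apply is_derive_Reals in hd2.
destruct (hd2 (l / 2)) as [d hd']; [lra|].
assert (hdp := cond_pos d).
set (t := Rmin (d / 2) ((b - x) / 2)).
assert (ht : 0 < t < d /\ x + t < b).
{ unfold t, Rmin; destruct (Rle_dec _ _); lra. }
assert (hpos : forall y, x < y <= x + t -> 0 < dg y).
{ intros y hy; specialize (hd' (y - x) ltac:(lra) ltac:(apply Rabs_def1; lra)).
  replace (x + (y - x)) with y in hd' by ring; rewrite h0 in hd'.
  apply Rabs_def2 in hd'.
  replace (dg y) with ((dg y - 0) / (y - x) * (y - x)) by (field; lra).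
  apply Rmult_lt_0_compat; lra. }
(* The derivative vanishes at [x] itself, so the strict increase is taken from the right half of the
   interval. *)
destruct (mean_value g dg (x + t / 2) (x + t)) as [c [hc ec]];
  [lra|intros y hy; apply hd; lra|].
assert (g x <= g (x + t / 2)).
{ apply (deriv_ge0_incr g dg); [lra|intros y hy; apply hd; lra|].
  intros y hy; destruct (Req_dec y x) as [->|]; [lra|].
  apply Rlt_le, hpos; lra. }
specialize (hpos c ltac:(lra)); specialize (hmax (x + t) ltac:(lra)); nra.
Qed.

(** * Shooting *)

Definition source (f V : R -> R) (x : R) : R := x ^ 4 * f (x ^ 2 * V x).
(** This is [V'] recovered from [(r^6 V')' = r^4 f(r^2 V)]. At 0 the numerator vanishes, so the
    quotient is 0 whatever [/ 0] is, and 0 is the right value of [V'] there. *)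
Definition flux (f V : R -> R) (x : R) : R := RInt (source f V) 0 x / x ^ 6.
Definition picard (f : R -> R) (a : R) (V : R -> R) (r : R) : R :=
  a + RInt (flux f V) 0 r.
Fixpoint picard_iter (f : R -> R) (a : R) (n : nat) : R -> R :=
  match n with O => fun _ => a | S n => picard f a (picard_iter f a n) end.
Definition shoot (f : R -> R) (a r : R) : R :=
  real (Lim_seq (fun n => picard_iter f a n r)).

Definition lipschitz (K : R) (f : R -> R) : Prop :=
  forall x y, Rabs (f x - f y) <= K * Rabs (x - y).

Lemma lipschitz_continuous K f x : lipschitz K f -> continuous f x.
Proof.
intros hf; apply continuity_pt_filterlim; intros e he.
assert (hK : 0 <= K).
{ generalize (hf 1 0) (Rabs_pos (f 1 - f 0)); rewrite Rminus_0_r, Rabs_R1; lra. }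
exists (e / (K + 1)); split; [apply Rdiv_lt_0_compat; lra|].
intros y [_ hy]; simpl in *; unfold R_dist in *.
apply Rle_lt_trans with (1 := hf y x).
apply Rle_lt_trans with ((K + 1) * Rabs (y - x)).
{ generalize (Rabs_pos (y - x)); nra. }
replace e with ((K + 1) * (e / (K + 1))) at 1 by (field; lra).
apply Rmult_lt_compat_l; lra.
Qed.

Lemma is_derive_primitive (g : R -> R) x :
  (forall y, continuous g y) -> is_derive (fun z => RInt g 0 z) x (g x).
Proof.
intros hc; apply (is_derive_RInt (V := R_CompleteNormedModule) g _ 0); [|apply hc].
apply filter_forall; intros y; apply (RInt_correct (V := R_CompleteNormedModule)).
apply (ex_RInt_continuous (V := R_CompleteNormedModule)); intros; apply hc.
Qed.

Lemma RInt_0_0 (g : R -> R) : RInt g 0 0 = 0.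
Proof. exact (RInt_point 0 g). Qed.

(* Comparison through an even majorant, so that both signs of [x] are covered. *)
Lemma abs_primitive_le (g h dh : R -> R) r :
  (forall y, continuous g y) -> (forall y, is_derive h y (dh y)) ->
  (forall y, 0 <= y <= Rabs r -> Rabs (g y) <= dh y) ->
  (forall y, - Rabs r <= y <= 0 -> Rabs (g y) <= - dh y) ->
  Rabs (RInt g 0 r) <= h r - h 0.
Proof.
intros hg hh hp hm.
assert (hG := fun y => is_derive_primitive g y hg).
assert (h1 : forall y, is_derive (fun z => h z - RInt g 0 z) y (dh y - g y)).
{ intros y; apply (is_derive_minus (V := R_NormedModule)); auto. }
assert (h2 : forall y, is_derive (fun z => h z + RInt g 0 z) y (dh y + g y)).
{ intros y; apply (is_derive_plus (V := R_NormedModule)); auto. }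
assert (e0 := RInt_0_0 g).
destruct (Rle_lt_dec 0 r) as [hr|hr].
- rewrite Rabs_pos_eq in hp by lra.
  assert (A1 := deriv_ge0_incr _ _ 0 r hr (fun y _ => h1 y)).
  assert (A2 := deriv_ge0_incr _ _ 0 r hr (fun y _ => h2 y)).
  simpl in A1, A2; rewrite e0 in A1, A2.
  apply Rabs_le; split.
  + assert (h 0 + 0 <= h r + RInt g 0 r); [apply A2|lra].
    intros y hy; specialize (hp y hy); apply Rabs_le_between in hp; lra.
  + assert (h 0 - 0 <= h r - RInt g 0 r); [apply A1|lra].
    intros y hy; specialize (hp y hy); apply Rabs_le_between in hp; lra.
- rewrite Rabs_left, Ropp_involutive in hm by lra.
  assert (A1 := deriv_le0_decr _ _ r 0 ltac:(lra) (fun y _ => h1 y)).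
  assert (A2 := deriv_le0_decr _ _ r 0 ltac:(lra) (fun y _ => h2 y)).
  simpl in A1, A2; rewrite e0 in A1, A2.
  apply Rabs_le; split.
  + assert (h 0 + 0 <= h r + RInt g 0 r); [apply A2|lra].
    intros y hy; specialize (hm y hy); apply Rabs_le_between in hm; lra.
  + assert (h 0 - 0 <= h r - RInt g 0 r); [apply A1|lra].
    intros y hy; specialize (hm y hy); apply Rabs_le_between in hm; lra.
Qed.

Lemma abs_primitive_le_const (g : R -> R) M r :
  (forall y, continuous g y) -> (forall y, Rabs y <= Rabs r -> Rabs (g y) <= M) ->
  Rabs (RInt g 0 r) <= M * Rabs r.
Proof.
intros hg hM.
assert (hG := fun y => is_derive_primitive g y hg).
assert (e0 := RInt_0_0 g).
destruct (Rle_lt_dec 0 r) as [hr|hr].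
- destruct (mean_value _ _ 0 r hr (fun y _ => hG y)) as [c [hc e]]; simpl in e.
  replace (RInt g 0 r) with (g c * (r - 0)) by lra.
  rewrite Rminus_0_r, Rabs_mult; apply Rmult_le_compat_r; [apply Rabs_pos|].
  apply hM; rewrite !Rabs_pos_eq; lra.
- destruct (mean_value _ _ r 0 ltac:(lra) (fun y _ => hG y)) as [c [hc e]]; simpl in e.
  replace (RInt g 0 r) with (g c * r) by lra.
  rewrite Rabs_mult; apply Rmult_le_compat_r; [apply Rabs_pos|].
  apply hM; rewrite !Rabs_left1; lra.
Qed.

Section Picard.
Variables (K : R) (f : R -> R).
Hypotheses (hK : 0 < K) (hf : lipschitz K f) (hf0 : f 0 = 0).

Lemma source_continuous V : (forall y, continuous V y) -> forall y, continuous (source f V) y.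
Proof.
intros hV y; unfold source.
apply (continuous_mult (K := R_AbsRing) (fun x => x ^ 4)).
{ apply (ex_derive_continuous (V := R_NormedModule)); auto_derive; trivial. }
apply (continuous_comp (fun x => x ^ 2 * V x) f).
- apply (continuous_mult (K := R_AbsRing) (fun x => x ^ 2)); [|apply hV].
  apply (ex_derive_continuous (V := R_NormedModule)); auto_derive; trivial.
- now apply lipschitz_continuous with K.
Qed.

Lemma source_diff U W y : Rabs (source f U y - source f W y) <= K * Rabs y ^ 6 * Rabs (U y - W y).
Proof.
unfold source; rewrite <- Rmult_minus_distr_l, Rabs_mult, <- RPow_abs.
assert (h := hf (y ^ 2 * U y) (y ^ 2 * W y)).
rewrite <- Rmult_minus_distr_l, Rabs_mult, <- RPow_abs in h.
assert (0 <= Rabs y ^ 4) by (apply pow_le, Rabs_pos).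
replace (K * Rabs y ^ 6 * Rabs (U y - W y))
  with (Rabs y ^ 4 * (K * (Rabs y ^ 2 * Rabs (U y - W y)))) by ring.
now apply Rmult_le_compat_l.
Qed.

Lemma flux_0 V : flux f V 0 = 0.
Proof. unfold flux; rewrite RInt_0_0; unfold Rdiv; ring. Qed.

(** The difference of the sources carries a factor [|y|^6], which cancels the division by [x^6]; the
    singularity at 0 therefore costs nothing. *)
Lemma flux_diff U W M x :
  (forall y, continuous U y) -> (forall y, continuous W y) ->
  (forall y, Rabs y <= Rabs x -> Rabs (U y - W y) <= M) ->
  Rabs (flux f U x - flux f W x) <= K * M * Rabs x.
Proof.
intros hU hW hM.
destruct (Req_dec x 0) as [->|hx].
{ rewrite !flux_0, Rminus_0_r, Rabs_R0; lra. }
assert (hx' : 0 < Rabs x) by now apply Rabs_pos_lt.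
assert (hM0 : 0 <= M) by (apply Rle_trans with (1 := Rabs_pos _) (2 := hM 0 ltac:(rewrite Rabs_R0; lra))).
unfold flux.
replace (RInt (source f U) 0 x / x ^ 6 - RInt (source f W) 0 x / x ^ 6)
  with (RInt (fun y => minus (source f U y) (source f W y)) 0 x / x ^ 6).
2: { rewrite (RInt_minus (V := R_CompleteNormedModule) (source f U) (source f W)).
     - unfold minus, plus, opp; simpl; field; exact hx.
     - apply (ex_RInt_continuous (V := R_CompleteNormedModule)); intros; now apply source_continuous.
     - apply (ex_RInt_continuous (V := R_CompleteNormedModule)); intros; now apply source_continuous. }
unfold Rdiv; rewrite Rabs_mult, Rabs_inv, <- RPow_abs.
assert (h6 : 0 < Rabs x ^ 6) by now apply pow_lt.
apply Rmult_le_reg_r with (1 := h6).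
rewrite Rmult_assoc, Rinv_l, Rmult_1_r by lra.
replace (K * M * Rabs x * Rabs x ^ 6) with ((K * Rabs x ^ 6 * M) * Rabs x) by ring.
apply abs_primitive_le_const.
- intros y; apply (continuous_minus (V := R_NormedModule)); now apply source_continuous.
- intros y hy; change (Rabs (source f U y - source f W y) <= K * Rabs x ^ 6 * M).
  apply Rle_trans with (1 := source_diff U W y).
  apply Rmult_le_compat; auto; try apply Rabs_pos.
  + apply Rmult_le_pos; [lra|apply pow_le, Rabs_pos].
  + apply Rmult_le_compat_l; [lra|]; apply pow_incr; split; [apply Rabs_pos|exact hy].
Qed.

Lemma continuous_bounded_at (V : R -> R) x0 : continuous V x0 ->
  exists d M, 0 < d /\ forall y, Rabs (y - x0) < d -> Rabs (V y) <= M.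
Proof.
intros hV; destruct (proj1 (filterlim_locally V (V x0)) hV (mkposreal 1 Rlt_0_1)) as [d hd].
exists d, (Rabs (V x0) + 1); split; [apply cond_pos|]; intros y hy.
specialize (hd y hy); change (Rabs (V y - V x0) < 1) in hd.
generalize (Rabs_triang_inv (V y) (V x0)); lra.
Qed.

Lemma flux_zero x : flux f (fun _ => 0) x = 0.
Proof.
unfold flux; rewrite (RInt_ext _ (fun _ => 0)).
- rewrite RInt_const; unfold scal; simpl; unfold mult; simpl; unfold Rdiv; now rewrite Rmult_0_r, Rmult_0_l.
- intros y _; unfold source; rewrite Rmult_0_r, hf0; apply Rmult_0_r.
Qed.

(** Only 0 is delicate: there [V] is compared with the zero function, whose flux vanishes because
    [f 0 = 0], and [flux_diff] gives a bound linear in [|x|]. *)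
Lemma flux_continuous V : (forall y, continuous V y) -> forall y, continuous (flux f V) y.
Proof.
intros hV y; destruct (Req_dec y 0) as [->|hy].
- destruct (continuous_bounded_at V 0 (hV 0)) as [d [M [hd hM]]].
  apply continuity_pt_filterlim; intros e he.
  assert (hM0 : 0 <= M).
  { apply Rle_trans with (1 := Rabs_pos (V 0)), hM; rewrite Rminus_0_r, Rabs_R0; lra. }
  exists (Rmin d (e / (K * M + 1))).
  assert (0 < K * M + 1) by nra.
  split; [apply Rmin_pos; [lra|apply Rdiv_lt_0_compat; lra]|].
  intros x [_ hx]; simpl in *; unfold R_dist in *.
  rewrite flux_0, Rminus_0_r; rewrite Rminus_0_r in hx.
  replace (flux f V x) with (flux f V x - flux f (fun _ => 0) x) by (rewrite flux_zero; ring).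
  apply Rle_lt_trans with (K * M * Rabs x).
  + apply flux_diff; auto.
    { intros; apply continuous_const. }
    intros z hz; rewrite Rminus_0_r; apply hM; rewrite Rminus_0_r.
    apply Rle_lt_trans with (1 := hz), Rlt_le_trans with (1 := hx), Rmin_l.
  + assert (hx2 : Rabs x < e / (K * M + 1)) by (apply Rlt_le_trans with (1 := hx), Rmin_r).
    replace e with ((K * M + 1) * (e / (K * M + 1))) by (field; lra).
    assert (hx3 := Rabs_pos x); nra.
- unfold flux, Rdiv; apply (continuous_mult (K := R_AbsRing) (fun x => RInt (source f V) 0 x)).
  + apply is_derive_cont with (source f V y), is_derive_primitive; now apply source_continuous.
  + apply (ex_derive_continuous (V := R_NormedModule)); auto_derive.
    now repeat apply Rmult_integral_contrapositive_currified.
Qed.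

Lemma picard_continuous a V : (forall y, continuous V y) -> forall y, continuous (picard f a V) y.
Proof.
intros hV y; apply (continuous_plus (V := R_NormedModule)); [apply continuous_const|].
apply is_derive_cont with (flux f V y), is_derive_primitive; now apply flux_continuous.
Qed.

(* The weight [exp (K r^2)] makes the Picard map a 1/2-contraction on every interval. *)
Lemma picard_contraction a b c U W r :
  (forall y, continuous U y) -> (forall y, continuous W y) ->
  (forall y, Rabs (U y - W y) <= c * exp (K * y ^ 2)) ->
  Rabs (picard f a U r - picard f b W r) <= Rabs (a - b) + c / 2 * exp (K * r ^ 2).
Proof.
intros hU hW hc.
assert (hc0 : 0 <= c).
{ generalize (hc 0) (Rabs_pos (U 0 - W 0)); rewrite pow_ne_zero by easy.
  rewrite Rmult_0_r, exp_0; lra. }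
unfold picard.
replace (a + RInt (flux f U) 0 r - (b + RInt (flux f W) 0 r))
  with ((a - b) + RInt (fun y => minus (flux f U y) (flux f W y)) 0 r).
2: { rewrite (RInt_minus (V := R_CompleteNormedModule) (flux f U) (flux f W)).
     - unfold minus, plus, opp; simpl; ring.
     - apply (ex_RInt_continuous (V := R_CompleteNormedModule)); intros; now apply flux_continuous.
     - apply (ex_RInt_continuous (V := R_CompleteNormedModule)); intros; now apply flux_continuous. }
apply Rle_trans with (1 := Rabs_triang _ _), Rplus_le_compat_l.
assert (hb : forall y, Rabs (minus (flux f U y) (flux f W y)) <= K * (c * exp (K * y ^ 2)) * Rabs y).
{ intros y; unfold minus, plus, opp; simpl; apply flux_diff; auto.
  intros z hz; apply Rle_trans with (1 := hc z), Rmult_le_compat_l; [exact hc0|].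
  assert (z ^ 2 <= y ^ 2) by (rewrite <- !Rsqr_pow2; now apply Rsqr_le_abs_1).
  destruct (Req_dec (z ^ 2) (y ^ 2)) as [->|]; [apply Rle_refl|].
  apply Rlt_le, exp_increasing; nra. }
eapply Rle_trans.
- apply (abs_primitive_le _ (fun y => c / 2 * exp (K * y ^ 2)) (fun y => c * K * y * exp (K * y ^ 2))).
  + intros y; apply (continuous_minus (V := R_NormedModule)); now apply flux_continuous.
  + intros y; auto_derive; trivial; simpl; field.
  + intros y hy; apply Rle_trans with (1 := hb y); rewrite Rabs_pos_eq by lra.
    apply Req_le; ring.
  + intros y hy; apply Rle_trans with (1 := hb y); rewrite Rabs_left1 by lra.
    apply Req_le; ring.
- rewrite pow_ne_zero, Rmult_0_r, exp_0 by easy; lra.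
Qed.

Lemma picard_iter_continuous a n : forall y, continuous (picard_iter f a n) y.
Proof.
induction n as [|n IH]; intros y; simpl; [apply continuous_const|].
now apply picard_continuous.
Qed.

Lemma exp_weight_ge1 r : 1 <= exp (K * r ^ 2).
Proof.
rewrite <- exp_0; destruct (Req_dec r 0) as [->|hr].
- rewrite pow_ne_zero, Rmult_0_r by easy; lra.
- apply Rlt_le, exp_increasing; assert (0 < r ^ 2) by now apply pow2_gt_0.
  nra.
Qed.

Lemma picard_iter_diff a n r :
  Rabs (picard_iter f a (S n) r - picard_iter f a n r) <= Rabs a * (1 / 2) ^ n * exp (K * r ^ 2).
Proof.
revert r; induction n as [|n IH]; intros r.
- simpl picard_iter.
  (* Since [f 0 = 0], the constant [a] is the Picard image of the zero function, so the first
     increment is also a difference of two Picard images. *)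
  replace (picard f a (fun _ => a) r - a)
    with (picard f a (fun _ => a) r - picard f a (fun _ => 0) r).
  + apply Rle_trans with (Rabs (a - a) + Rabs a / 2 * exp (K * r ^ 2)).
    * apply picard_contraction; [intros; apply continuous_const|intros; apply continuous_const|].
      intros y; rewrite Rminus_0_r; generalize (exp_weight_ge1 y) (Rabs_pos a); nra.
    * rewrite Rminus_diag, Rabs_R0, Rplus_0_l, pow_O, Rmult_1_r.
      generalize (exp_weight_ge1 r) (Rabs_pos a); nra.
  + unfold picard; rewrite (RInt_ext (flux f (fun _ => 0)) (fun _ => 0)).
    * rewrite RInt_const; unfold scal; simpl; unfold mult; simpl; lra.
    * intros; apply flux_zero.
- change (picard_iter f a (S (S n))) with (picard f a (picard_iter f a (S n))).
  change (picard_iter f a (S n) r) with (picard f a (picard_iter f a n) r).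
  apply Rle_trans with (Rabs (a - a) + Rabs a * (1 / 2) ^ n / 2 * exp (K * r ^ 2)).
  + apply picard_contraction; try apply picard_iter_continuous; exact IH.
  + rewrite Rminus_diag, Rabs_R0; apply Req_le; simpl; field.
Qed.

Lemma geometric_cauchy (x : nat -> R) c :
  (forall n, Rabs (x (S n) - x n) <= c * (1 / 2) ^ n) ->
  is_lim_seq x (real (Lim_seq x)) /\
  forall n, Rabs (real (Lim_seq x) - x n) <= 2 * c * (1 / 2) ^ n.
Proof.
intros hx.
assert (hc : 0 <= c) by (generalize (hx O) (Rabs_pos (x 1%nat - x O)); simpl; lra).
assert (hnm : forall n k, Rabs (x (n + k)%nat - x n) <= 2 * c * (1 / 2) ^ n * (1 - (1 / 2) ^ k)).
{ intros n; induction k as [|k IH].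
  - rewrite Nat.add_0_r, Rminus_diag, Rabs_R0; simpl; lra.
  - replace (x (n + S k)%nat - x n)
      with ((x (S (n + k)) - x (n + k)%nat) + (x (n + k)%nat - x n))
      by (rewrite Nat.add_succ_r; ring).
    apply Rle_trans with (1 := Rabs_triang _ _).
    specialize (hx (n + k)%nat); rewrite pow_add in hx; simpl; nra. }
assert (hnm' : forall n k, Rabs (x (n + k)%nat - x n) <= 2 * c * (1 / 2) ^ n).
{ intros n k; apply Rle_trans with (1 := hnm n k).
  assert (0 <= (1 / 2) ^ n) by (apply pow_le; lra).
  assert (0 <= (1 / 2) ^ k) by (apply pow_le; lra).
  assert (0 <= c * (1 / 2) ^ n) by now apply Rmult_le_pos.
  nra. }
assert (hlim : is_lim_seq x (real (Lim_seq x))).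
{ apply Lim_seq_correct', ex_lim_seq_cauchy_corr.
  intros e.
  destruct (pow_lt_1_zero (1 / 2) ltac:(rewrite Rabs_pos_eq; lra) (e / (4 * c + 1))) as [N hN].
  { apply Rdiv_lt_0_compat; [apply cond_pos|lra]. }
  exists N; intros n m hn hm.
  assert (h1 := hnm' N (n - N)%nat); assert (h2 := hnm' N (m - N)%nat).
  replace (N + (n - N))%nat with n in h1 by lia.
  replace (N + (m - N))%nat with m in h2 by lia.
  specialize (hN N (le_n N)); rewrite Rabs_pos_eq in hN by (apply pow_le; lra).
  replace (x n - x m) with ((x n - x N) - (x m - x N)) by ring.
  apply Rle_lt_trans with (1 := Rabs_triang _ _); rewrite Rabs_Ropp.
  assert (h3 : (4 * c + 1) * (1 / 2) ^ N < e).
  { replace (pos e) with ((4 * c + 1) * (e / (4 * c + 1))) by (field; lra).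
    apply Rmult_lt_compat_l; lra. }
  assert (0 < (1 / 2) ^ N) by (apply pow_lt; lra); lra. }
split; [exact hlim|]; intros n.
apply (is_lim_seq_le (fun k => Rabs (x (k + n)%nat - x n)) (fun _ => 2 * c * (1 / 2) ^ n)
  (Rabs (real (Lim_seq x) - x n)) (2 * c * (1 / 2) ^ n)).
- intros k; rewrite Nat.add_comm; apply hnm'.
- apply (is_lim_seq_abs _ (Finite _)).
  apply is_lim_seq_minus'; [|apply is_lim_seq_const].
  now apply (is_lim_seq_incr_n x n).
- apply is_lim_seq_const.
Qed.

Lemma shoot_lim a r : is_lim_seq (fun n => picard_iter f a n r) (shoot f a r) /\
  forall n, Rabs (shoot f a r - picard_iter f a n r)
            <= 2 * Rabs a * exp (K * r ^ 2) * (1 / 2) ^ n.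
Proof.
destruct (geometric_cauchy (fun n => picard_iter f a n r) (Rabs a * exp (K * r ^ 2))) as [h1 h2].
- intros n; generalize (picard_iter_diff a n r); lra.
- split; [exact h1|]; intros n; generalize (h2 n); unfold shoot; lra.
Qed.

Lemma pow_half_lt e c : 0 < e -> 0 <= c -> exists n, c * (1 / 2) ^ n < e.
Proof.
intros he hc.
destruct (pow_lt_1_zero (1 / 2) ltac:(rewrite Rabs_pos_eq; lra) (e / (c + 1))) as [N hN].
{ apply Rdiv_lt_0_compat; lra. }
exists N; specialize (hN N (le_n N)); rewrite Rabs_pos_eq in hN by (apply pow_le; lra).
assert (0 < (1 / 2) ^ N) by (apply pow_lt; lra).
assert ((c + 1) * (1 / 2) ^ N < e); [|lra].
replace e with ((c + 1) * (e / (c + 1))) by (field; lra).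
apply Rmult_lt_compat_l; lra.
Qed.

(** The weight [exp (K r^2)] is bounded for [|x| <= |y| + 1], so the iterates converge uniformly
    there. *)
Lemma shoot_continuous a y : continuous (shoot f a) y.
Proof.
apply continuity_pt_filterlim; intros e he.
set (w := exp (K * (Rabs y + 1) ^ 2)).
assert (hw : 0 < w) by apply exp_pos.
destruct (pow_half_lt (e / 3) (2 * Rabs a * w)) as [n hn]; [lra| |].
{ generalize (Rabs_pos a); nra. }
assert (hloc : forall x, Rabs x <= Rabs y + 1 ->
  Rabs (shoot f a x - picard_iter f a n x) < e / 3).
{ intros x hx; apply Rle_lt_trans with (1 := proj2 (shoot_lim a x) n).
  apply Rle_lt_trans with (2 := hn); apply Rmult_le_compat_r; [apply pow_le; lra|].
  apply Rmult_le_compat_l; [generalize (Rabs_pos a); lra|].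
  assert (x ^ 2 <= (Rabs y + 1) ^ 2).
  { rewrite <- !Rsqr_pow2; apply Rsqr_le_abs_1.
    rewrite (Rabs_pos_eq (Rabs y + 1)); [exact hx|generalize (Rabs_pos y); lra]. }
  destruct (Req_dec (x ^ 2) ((Rabs y + 1) ^ 2)) as [e1|]; [unfold w; rewrite e1; lra|].
  apply Rlt_le, exp_increasing; nra. }
assert (hc := picard_iter_continuous a n y).
apply continuity_pt_filterlim in hc.
destruct (hc (e / 3) ltac:(lra)) as [d [hd hd']].
exists (Rmin d 1); split; [apply Rmin_pos; lra|].
intros x [hx1 hx2]; simpl in *; unfold R_dist in *.
assert (Rabs (x - y) < d) by (apply Rlt_le_trans with (1 := hx2), Rmin_l).
assert (hx3 : Rabs (x - y) < 1) by (apply Rlt_le_trans with (1 := hx2), Rmin_r).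
specialize (hd' x (conj hx1 H)).
assert (Rabs x <= Rabs y + 1).
{ generalize (Rabs_triang (x - y) y); replace (x - y + y) with x by ring; lra. }
assert (h1 := hloc x H0); assert (h2 := hloc y ltac:(lra)).
apply Rabs_def2 in h1; apply Rabs_def2 in h2; apply Rabs_def2 in hd'.
apply Rabs_def1; lra.
Qed.

(** For every [n] the two sides differ by at most [2 |a| exp (K r^2) (1/2)^n]: half of it is the
    contracted error of iterate [n], half the error of iterate [n + 1]. *)
Lemma shoot_fixed a r : picard f a (shoot f a) r = shoot f a r.
Proof.
apply Rminus_diag_uniq, NNPP; intros hn.
assert (hp := Rabs_pos_lt _ hn).
assert (hE := exp_pos (K * r ^ 2)); assert (ha := Rabs_pos a).
destruct (pow_half_lt (Rabs (picard f a (shoot f a) r - shoot f a r))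
  (2 * Rabs a * exp (K * r ^ 2))) as [n h]; [exact hp|nra|].
apply (Rlt_irrefl (Rabs (picard f a (shoot f a) r - shoot f a r))).
apply Rle_lt_trans with (2 := h).
replace (picard f a (shoot f a) r - shoot f a r) with
  ((picard f a (shoot f a) r - picard_iter f a (S n) r)
   - (shoot f a r - picard_iter f a (S n) r)) by ring.
apply Rle_trans with (1 := Rabs_triang _ _); rewrite Rabs_Ropp.
assert (h1 := proj2 (shoot_lim a r) (S n)).
change ((1 / 2) ^ S n) with (1 / 2 * (1 / 2) ^ n) in h1.
assert (h2 : Rabs (picard f a (shoot f a) r - picard_iter f a (S n) r)
  <= Rabs (a - a) + (2 * Rabs a * (1 / 2) ^ n) / 2 * exp (K * r ^ 2)).
{ apply picard_contraction.
  - apply shoot_continuous.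
  - apply picard_iter_continuous.
  - intros y; apply Rle_trans with (1 := proj2 (shoot_lim a y) n), Req_le; ring. }
rewrite Rminus_diag, Rabs_R0 in h2.
set (p := (1 / 2) ^ n) in *; set (E := exp (K * r ^ 2)) in *.
eapply Rle_trans; [exact (Rplus_le_compat _ _ _ _ h2 h1)|apply Req_le; field].
Qed.

(** The constant 2 is the fixed point of [c -> 1 + c / 2], and the weight is at least 1. The
    resulting continuity in the slope feeds the intermediate value theorem. *)
Lemma shoot_lipschitz a b r :
  Rabs (shoot f a r - shoot f b r) <= 2 * Rabs (a - b) * exp (K * r ^ 2).
Proof.
assert (hn : forall n r, Rabs (picard_iter f a n r - picard_iter f b n r)
  <= 2 * Rabs (a - b) * exp (K * r ^ 2)).
{ induction n as [|n IH]; intros x; simpl picard_iter.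
  - assert (h1 := exp_weight_ge1 x); assert (h2 := Rabs_pos (a - b)); nra.
  - eapply Rle_trans.
    + apply picard_contraction; try apply picard_iter_continuous; exact IH.
    + assert (h1 := exp_weight_ge1 x); assert (h2 := Rabs_pos (a - b)); nra. }
apply (is_lim_seq_le (fun n => Rabs (picard_iter f a n r - picard_iter f b n r))
  (fun _ => 2 * Rabs (a - b) * exp (K * r ^ 2)) (Rabs (shoot f a r - shoot f b r))
  (2 * Rabs (a - b) * exp (K * r ^ 2))).
- intros n; apply hn.
- apply (is_lim_seq_abs _ (Finite _)), is_lim_seq_minus'; apply shoot_lim.
- apply is_lim_seq_const.
Qed.

Lemma shoot_zero r : shoot f 0 r = 0.
Proof.
assert (h := proj2 (shoot_lim 0 r) O); simpl in h.
rewrite Rabs_R0, Rmult_0_r, !Rmult_0_l, Rminus_0_r in h.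
apply NNPP; intros hn; apply Rabs_pos_lt in hn; lra.
Qed.

End Picard.

(** Negative [r] are included so that derivatives at 0 are two-sided. Differentiating [x^6 V1] keeps
    the equation meaningful at 0, where the formula for the derivative of [V1] divides by zero. *)
Definition radial (f V V1 : R -> R) : Prop :=
  forall r, is_derive V r (V1 r) /\ is_derive (fun x => x ^ 6 * V1 x) r (source f V r).

Lemma shoot_radial K f a : 0 < K -> lipschitz K f -> f 0 = 0 ->
  shoot f a 0 = a /\ radial f (shoot f a) (flux f (shoot f a)).
Proof.
intros hK hf hf0.
assert (hc : forall y, continuous (shoot f a) y) by (intros; eapply shoot_continuous; eauto).
assert (hfix : forall r, picard f a (shoot f a) r = shoot f a r).
{ intros; eapply shoot_fixed; eauto. }
split.
{ rewrite <- hfix; unfold picard; rewrite RInt_0_0; ring. }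
intros r; split.
- apply (is_derive_ext (picard f a (shoot f a))); [exact hfix|].
  unfold picard; replace (flux f (shoot f a) r) with (0 + flux f (shoot f a) r) by ring.
  apply (is_derive_plus (V := R_NormedModule)); [apply (is_derive_const (V := R_NormedModule))|].
  apply is_derive_primitive; eapply flux_continuous; eauto.
- apply (is_derive_ext (fun x => RInt (source f (shoot f a)) 0 x)).
  + intros x; unfold flux; destruct (Req_dec x 0) as [->|hx].
    * rewrite RInt_0_0; simpl; lra.
    * assert (h : forall y : R, y = x ^ 6 * (y / x ^ 6)) by (intros; field; exact hx).
      apply h.
  + apply is_derive_primitive; eapply source_continuous; eauto.
Qed.

(** * From profiles to solutions *)

Lemma flux_derive (f V V1 : R -> R) r : r <> 0 ->
  is_derive (fun x => x ^ 6 * V1 x) r (source f V r) ->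
  is_derive V1 r (f (r ^ 2 * V r) / r ^ 2 - 6 * V1 r / r).
Proof.
intros hr H2.
assert (hloc : locally r (fun x => x <> 0)).
{ assert (hp := Rabs_pos_lt r hr); exists (mkposreal _ hp); intros y hy ->.
  change (Rabs (0 - r) < Rabs r) in hy; rewrite Rminus_0_l, Rabs_Ropp in hy; lra. }
apply (is_derive_ext_loc (fun x => (x ^ 6 * V1 x) * / x ^ 6)).
{ apply filter_imp with (2 := hloc); intros x hx.
  assert (h : forall y : R, x ^ 6 * y * / x ^ 6 = y) by (intros; field; exact hx).
  apply h. }
replace (f (r ^ 2 * V r) / r ^ 2 - 6 * V1 r / r)
  with (source f V r * / r ^ 6 + (r ^ 6 * V1 r) * (- (6 * r ^ 5) / (r ^ 6) ^ 2))
  by (unfold source; field; exact hr).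
apply (is_derive_mult (K := R_AbsRing) (fun x => x ^ 6 * V1 x) (fun x => / x ^ 6)); [exact H2| |].
- auto_derive; [now repeat apply Rmult_integral_contrapositive_currified|].
  field; exact hr.
- exact Rmult_comm.
Qed.

Lemma radial_derive2 (f V V1 : R -> R) r : radial f V V1 -> r <> 0 ->
  is_derive V1 r (f (r ^ 2 * V r) / r ^ 2 - 6 * V1 r / r).
Proof. intros H hr; apply flux_derive; [exact hr|apply H]. Qed.

Definition profile (V : R -> R) (r : R) : R := r ^ 2 * V r.
Definition profile1 (V V1 : R -> R) (r : R) : R := 2 * r * V r + r ^ 2 * V1 r.

Lemma profile_derive f V V1 r : radial f V V1 -> is_derive (profile V) r (profile1 V V1 r).
Proof.
intros H; unfold profile, profile1.
apply (is_derive_mult (K := R_AbsRing) (fun x => x ^ 2) V).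
- auto_derive; trivial; simpl; ring.
- apply H.
- exact Rmult_comm.
Qed.

Lemma profile_derive2 f V V1 r : radial f V V1 -> r <> 0 ->
  is_derive (profile1 V V1) r (2 * V r - 2 * r * V1 r + f (profile V r)).
Proof.
intros H hr; unfold profile1.
replace (2 * V r - 2 * r * V1 r + f (profile V r)) with
  ((2 * V r + 2 * r * V1 r) + (2 * r * V1 r + r ^ 2 * (f (r ^ 2 * V r) / r ^ 2 - 6 * V1 r / r)))
  by (unfold profile; field; exact hr).
apply (is_derive_plus (V := R_NormedModule)).
- apply (is_derive_mult (K := R_AbsRing) (fun x => 2 * x) V).
  + auto_derive; trivial; ring.
  + apply H.
  + exact Rmult_comm.
- apply (is_derive_mult (K := R_AbsRing) (fun x => x ^ 2) V1).
  + auto_derive; trivial; simpl; ring.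
  + now apply radial_derive2.
  + exact Rmult_comm.
Qed.

Lemma radial_continuous f V V1 r : radial f V V1 -> continuous V r.
Proof. intros H; apply is_derive_cont with (V1 r), H. Qed.

Lemma locally_pos r : 0 < r -> locally r (fun x => 0 < x).
Proof. intros hr; apply (open_gt 0 r hr). Qed.

Lemma radial_is_solution (f F V V1 : R -> R) (L s : R) :
  0 < L -> radial f V V1 -> (forall t, continuous f t) ->
  (forall r, 0 < r < L -> f (profile V r) = F (profile V r)) ->
  profile V L = s -> is_solution F L s (profile V).
Proof.
intros hL H hf hfF hs.
assert (d1 : forall r, Derive_n (profile V) 1 r = profile1 V V1 r).
{ intros r; simpl; apply is_derive_unique, (profile_derive _ _ _ _ H). }
assert (d2 : forall r, 0 < r -> Derive_n (profile V) 2 r = 2 * V r - 2 * r * V1 r + f (profile V r)).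
{ intros r hr; change (Derive_n (profile V) 2 r) with (Derive (Derive_n (profile V) 1) r).
  rewrite (Derive_ext _ _ _ d1); apply is_derive_unique, (profile_derive2 _ _ _ _ H); lra. }
assert (hcont : forall r, continuous (profile V) r).
{ intros r; apply is_derive_cont with (profile1 V V1 r), (profile_derive _ _ _ _ H). }
split; [|split; [|split]].
- intros r hr; split.
  + intros j hj; destruct j as [|[|[|j]]]; [exact I| | |lia].
    * exists (profile1 V V1 r); apply (profile_derive _ _ _ _ H).
    * apply (ex_derive_ext (profile1 V V1)); [intros; symmetry; apply d1|].
      exists (2 * V r - 2 * r * V1 r + f (profile V r)).
      apply (profile_derive2 _ _ _ _ H); lra.
  + apply (continuous_ext_loc _ (fun r => 2 * V r - 2 * r * V1 r + f (profile V r))).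
    { apply filter_imp with (2 := locally_pos r (proj1 hr)); intros; symmetry; now apply d2. }
    apply (continuous_plus (V := R_NormedModule)).
    * apply (continuous_minus (V := R_NormedModule)).
      -- apply (continuous_mult (K := R_AbsRing)); [apply continuous_const|].
         apply (radial_continuous _ _ _ _ H).
      -- apply (continuous_mult (K := R_AbsRing) (fun r => 2 * r)).
         ++ apply (ex_derive_continuous (V := R_NormedModule)); auto_derive; trivial.
         ++ eapply is_derive_cont, (radial_derive2 _ _ _ _ H); lra.
    * apply (continuous_comp (profile V) f); [apply hcont|apply hf].
- intros r hr; rewrite d2 by lra.
  change (Derive (profile V) r) with (Derive_n (profile V) 1 r); rewrite d1.
  rewrite <- hfF by exact hr; unfold profile1, profile; field; lra.
- replace 0 with (profile V 0) at 2 by (unfold profile; ring).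
  apply filterlim_filter_le_1 with (2 := hcont 0).
  intros P [e he]; exists e; intros y hy _; now apply he.
- rewrite <- hs; apply filterlim_filter_le_1 with (2 := hcont L).
  intros P [e he]; exists e; intros y hy _; now apply he.
Qed.

Lemma exists_max (g : R -> R) a b : a <= b -> (forall x, a <= x <= b -> continuous g x) ->
  exists x, a <= x <= b /\ forall y, a <= y <= b -> g y <= g x.
Proof.
intros hab hc; destruct (continuity_ab_maj g a b hab) as [x [h1 h2]].
- intros x hx; now apply continuity_pt_filterlim, hc.
- exists x; split; auto.
Qed.

(** At an interior maximum above [s] the source vanishes, and [u' = 0] means [r V' = - 2 V]; hence
    [u'' = 6 V > 0], which is impossible. *)
Lemma profile_le f V V1 L s : 0 < L -> 0 < s -> radial f V V1 ->
  (forall t, s < t -> f t = 0) -> profile V L = s ->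
  forall r, 0 <= r <= L -> profile V r <= s.
Proof.
intros hL hs H hf hVL r hr.
destruct (exists_max (profile V) 0 L ltac:(lra)) as [x [hx hmax]].
{ intros y _; apply is_derive_cont with (profile1 V V1 y), (profile_derive _ _ _ _ H). }
apply Rnot_lt_le; intros hlt.
assert (hxs : s < profile V x) by (specialize (hmax r hr); lra).
assert (hx0 : 0 < x < L).
{ split.
  - destruct (Req_dec x 0) as [->|]; [unfold profile in hxs; lra|lra].
  - destruct (Req_dec x L) as [->|]; lra. }
destruct (interior_max_second_derivative (profile V) (profile1 V V1) x
  (2 * V x - 2 * x * V1 x + f (profile V x)) 0 L hx0) as [h1 h2].
- intros y _; apply (profile_derive _ _ _ _ H).
- apply (profile_derive2 _ _ _ _ H); lra.
- intros y hy; apply hmax; lra.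
- rewrite hf in h2 by exact hxs; unfold profile, profile1 in *.
  assert (0 < V x) by (apply Rmult_lt_reg_l with (x ^ 2); nra).
  assert (x * V1 x = - 2 * V x) by (apply Rmult_eq_reg_l with x; nra).
  lra.
Qed.

(** * Existence of the non-negative solution *)

Definition truncate (F : R -> R) (lo hi t : R) : R := F (Rmax lo (Rmin t hi)).

Lemma truncate_in F lo hi t : lo <= t <= hi -> truncate F lo hi t = F t.
Proof.
intros h; unfold truncate; rewrite Rmin_left, Rmax_right by lra; reflexivity.
Qed.

Lemma truncate_above F lo hi t : lo <= hi -> hi <= t -> truncate F lo hi t = F hi.
Proof.
intros h h'; unfold truncate; rewrite Rmin_right, Rmax_right by lra; reflexivity.
Qed.

Lemma truncate_below F lo hi t : lo <= hi -> t <= lo -> truncate F lo hi t = F lo.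
Proof.
intros h h'; unfold truncate; rewrite Rmin_left, Rmax_left by lra; reflexivity.
Qed.

Lemma truncate_lipschitz F lo hi K : lo <= hi -> 0 <= K ->
  (forall x y, lo <= x <= hi -> lo <= y <= hi -> Rabs (F x - F y) <= K * Rabs (x - y)) ->
  lipschitz K (truncate F lo hi).
Proof.
intros hlh hK h x y; unfold truncate.
apply Rle_trans with (K * Rabs (Rmax lo (Rmin x hi) - Rmax lo (Rmin y hi))).
- apply h; unfold Rmax, Rmin; repeat destruct (Rle_dec _ _); lra.
- apply Rmult_le_compat_l; [exact hK|].
  unfold Rmax, Rmin; repeat destruct (Rle_dec _ _); unfold Rabs; repeat destruct (Rcase_abs _); lra.
Qed.

Lemma C1_derive F x : class_C 1 (fun _ => True) F -> is_derive F x (Derive F x).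
Proof. intros H; apply Derive_correct; now apply (proj1 (H x I) 1%nat). Qed.

Lemma C1_lipschitz F lo hi : class_C 1 (fun _ => True) F -> lo <= hi ->
  exists K, 0 < K /\
  forall x y, lo <= x <= hi -> lo <= y <= hi -> Rabs (F x - F y) <= K * Rabs (x - y).
Proof.
intros HF hlh.
destruct (exists_max (fun x => Rabs (Derive F x)) lo hi hlh) as [m [hm hmax]].
{ intros x _; apply (continuous_comp (Derive F) Rabs); [apply (proj2 (HF x I))|apply continuous_Rabs]. }
exists (Rabs (Derive F m) + 1); split; [generalize (Rabs_pos (Derive F m)); lra|].
assert (hw : forall x y, lo <= x <= hi -> lo <= y <= hi -> x <= y ->
  Rabs (F x - F y) <= (Rabs (Derive F m) + 1) * Rabs (x - y)).
{ intros x y hx hy hxy.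
  destruct (mean_value F (Derive F) x y hxy) as [c [hc e]].
  { intros; now apply C1_derive. }
  rewrite (Rabs_minus_sym (F x)), (Rabs_minus_sym x), e, Rabs_mult.
  apply Rmult_le_compat_r; [apply Rabs_pos|]; specialize (hmax c ltac:(lra)); lra. }
intros x y hx hy; destruct (Rle_lt_dec x y); [now apply hw|].
rewrite (Rabs_minus_sym (F x)), (Rabs_minus_sym x); apply hw; lra.
Qed.

Lemma ivt (g : R -> R) a b y : a <= b -> (forall x, continuous g x) -> g a <= y <= g b ->
  exists x, a <= x <= b /\ g x = y.
Proof.
intros hab hg hy.
destruct (Req_dec (g a) y) as [e|n1]; [exists a; split; [lra|exact e]|].
destruct (first_zero (fun x => y - g x) a b hab) as [c [h1 [h2 _]]]; try lra.
{ intros x _; apply (continuous_minus (V := R_NormedModule)); [apply continuous_const|apply hg]. }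
exists c; split; lra.
Qed.

Lemma shoot_continuous_in_slope K f r : 0 < K -> lipschitz K f -> f 0 = 0 ->
  forall a, continuous (fun a => shoot f a r) a.
Proof.
intros hK hf hf0 a0; apply (lipschitz_continuous (2 * exp (K * r ^ 2))).
intros a b; apply Rle_trans with (1 := shoot_lipschitz K f hK hf hf0 a b r), Req_le; ring.
Qed.

Lemma nonneg_solution_exists (F : R -> R) (L s : R) :
  0 < L -> 0 < s -> class_C 1 (fun _ => True) F -> F 0 = 0 -> F s = 0 ->
  (forall t, 0 < t < s -> F t < 0) ->
  exists u, is_solution F L s u /\ nonneg_on L u.
Proof.
intros hL hs HF F0 Fs hneg.
destruct (C1_lipschitz F 0 s HF ltac:(lra)) as [K [hK hlip]].
set (f := truncate F 0 s).
assert (hf : lipschitz K f) by (apply truncate_lipschitz; lra || exact hlip).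
assert (f_in : forall t, 0 <= t <= s -> f t = F t) by (intros; now apply truncate_in).
assert (f_hi : forall t, s < t -> f t = 0) by (intros; unfold f; rewrite truncate_above; lra).
assert (f_lo : forall t, t <= 0 -> f t = 0) by (intros; unfold f; rewrite truncate_below; lra).
assert (f0 : f 0 = 0) by (apply f_lo; lra).
assert (f_le0 : forall t, f t <= 0).
{ intros t; destruct (Rle_lt_dec t 0); [rewrite f_lo; lra|].
  destruct (Rlt_le_dec s t); [rewrite f_hi; lra|].
  rewrite f_in by lra; destruct (Req_dec t s) as [->|]; [lra|].
  apply Rlt_le, hneg; lra. }
assert (f_B : forall t, Rabs (f t) <= K * s).
{ intros t; destruct (Rle_lt_dec t 0); [rewrite f_lo, Rabs_R0; nra|].
  destruct (Rlt_le_dec s t); [rewrite f_hi, Rabs_R0; nra|].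
  generalize (hf t 0); rewrite f0, !Rminus_0_r, (Rabs_pos_eq t) by lra; nra. }
assert (hrad := fun a => shoot_radial K f a hK hf f0).
assert (hV1 : forall a r, 0 <= r -> flux f (shoot f a) r <= 0).
{ intros a r hr; destruct (Req_dec r 0) as [->|]; [rewrite flux_0; lra|].
  assert (h := deriv_le0_decr _ _ 0 r hr (fun y _ => proj2 (proj2 (hrad a) y))).
  simpl in h; rewrite Rmult_0_l, Rmult_0_l in h.
  assert (h' : r ^ 6 * flux f (shoot f a) r <= 0).
  { apply h; intros y hy; unfold source; specialize (f_le0 (y ^ 2 * shoot f a y)).
    assert (0 <= y ^ 4) by (apply pow_le; lra); nra. }
  assert (0 < r ^ 6) by (apply pow_lt; lra); nra. }
(* For [V <= a] the bounds [|f t| <= K t] and [|f t| <= K s] give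
   [|f (x^2 V)| <= q x] with [q^2 = K^2 s a]. *)
assert (hbig : forall q, 0 < q -> q ^ 2 / (K ^ 2 * s) - q * L / 6 <= shoot f (q ^ 2 / (K ^ 2 * s)) L).
{ intros q hq; set (a := q ^ 2 / (K ^ 2 * s)).
  assert (ha : K ^ 2 * s * a = q ^ 2) by (unfold a; field; lra).
  assert (ha0 : 0 < a) by (unfold a; apply Rdiv_lt_0_compat; repeat apply Rmult_lt_0_compat; lra).
  destruct (hrad a) as [V0 HV]; set (V := shoot f a) in *; set (V1 := flux f V) in *.
  assert (hVa : forall r, 0 <= r -> V r <= a).
  { intros r hr; rewrite <- V0.
    apply (deriv_le0_decr V V1); [exact hr|intros; apply HV|]; intros; apply hV1; lra. }
  (* The linear bound on [f] alone would cost a fixed multiple of [a], and the constant bound alone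
     leaves [V'] of order [1 / r], not integrable at 0. Their geometric mean avoids both defects. *)
  assert (hfb : forall r, 0 <= r -> - (q * r) <= f (r ^ 2 * V r)).
  { intros r hr; set (t := r ^ 2 * V r).
    destruct (Rle_lt_dec t 0) as [hn|hp]; [rewrite f_lo by exact hn; nra|].
    assert (h1 := hf t 0); rewrite f0, !Rminus_0_r, (Rabs_pos_eq t) in h1 by lra.
    assert (h2 := f_B t); rewrite Rabs_left1 in h1, h2 by apply f_le0.
    assert (ht : t <= r ^ 2 * a) by (apply Rmult_le_compat_l; [nra|now apply hVa]).
    assert (h0 := f_le0 t); apply Rnot_lt_le; intros hlt.
    assert (h3 : (- f t) * (- f t) <= (K * t) * (K * s)) by (apply Rmult_le_compat; lra).
    assert (h4 : (q * r) * (q * r) < (- f t) * (- f t)).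
    { apply Rmult_le_0_lt_compat; nra. }
    assert (h5 : (K * t) * (K * s) <= (K * (r ^ 2 * a)) * (K * s)).
    { apply Rmult_le_compat_r; [nra|]; apply Rmult_le_compat_l; lra. }
    nra. }
  assert (hPl : forall r, 0 <= r -> - (q / 6) * r ^ 6 <= r ^ 6 * V1 r).
  { intros r hr.
    assert (h : 0 ^ 6 * V1 0 + q / 6 * 0 ^ 6 <= r ^ 6 * V1 r + q / 6 * r ^ 6); [|lra].
    apply (deriv_ge0_incr (fun x => x ^ 6 * V1 x + q / 6 * x ^ 6)
      (fun x => source f V x + q / 6 * (6 * x ^ 5))); [exact hr| |].
    - intros x _; apply (is_derive_plus (V := R_NormedModule) (fun x => x ^ 6 * V1 x)); [apply HV|].
      auto_derive; trivial; simpl; ring.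
    - intros x hx; unfold source.
      replace (q / 6 * (6 * x ^ 5)) with (x ^ 4 * (q * x)) by field.
      rewrite <- Rmult_plus_distr_l; apply Rmult_le_pos; [apply pow_le; lra|].
      specialize (hfb x ltac:(lra)); lra. }
  destruct (mean_value V V1 0 L ltac:(lra)) as [c [hc e]]; [intros; apply HV|].
  rewrite V0 in e.
  assert (- (q / 6) <= V1 c); [|nra].
  destruct (Req_dec c 0) as [->|]; [unfold V1; rewrite flux_0; lra|].
  specialize (hPl c ltac:(lra)); assert (0 < c ^ 6) by (apply pow_lt; lra); nra. }
(* The lower bound of [hbig] is [q] times a factor. The first two summands make this factor at least
   1, the third makes [q] at least [s / L^2]. *)
set (q := K ^ 2 * s * (L / 6) + K ^ 2 * s + s / L ^ 2).
assert (hL2 : 0 < L ^ 2) by now apply pow_lt.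
assert (hK2 : 0 < K ^ 2 * s) by (apply Rmult_lt_0_compat; [now apply pow_lt|lra]).
assert (hsL : 0 < s / L ^ 2) by now apply Rdiv_lt_0_compat.
assert (hq : 0 < q) by (unfold q; nra).
assert (hend : s / L ^ 2 <= shoot f (q ^ 2 / (K ^ 2 * s)) L).
{ apply Rle_trans with (2 := hbig q hq).
  replace (q ^ 2 / (K ^ 2 * s) - q * L / 6) with (q * ((q - K ^ 2 * s * (L / 6)) / (K ^ 2 * s)))
    by (field; lra).
  assert (1 <= (q - K ^ 2 * s * (L / 6)) / (K ^ 2 * s)).
  { apply (Rle_div_r _ _ _ hK2); unfold q; lra. }
  assert (s / L ^ 2 <= q) by (unfold q; nra).
  nra. }
destruct (ivt (fun a => shoot f a L) 0 (q ^ 2 / (K ^ 2 * s)) (s / L ^ 2)) as [a [ha e]].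
{ apply Rlt_le, Rdiv_lt_0_compat; [now apply pow_lt|exact hK2]. }
{ now apply (shoot_continuous_in_slope K). }
{ rewrite (shoot_zero K) by assumption; lra. }
destruct (hrad a) as [V0 HV]; set (V := shoot f a) in *; set (V1 := flux f V) in *.
exists (profile V).
assert (hVL : profile V L = s) by (unfold profile; rewrite e; field; lra).
assert (hle := profile_le f V V1 L s hL hs HV f_hi hVL).
assert (hpos : forall r, 0 <= r <= L -> 0 <= profile V r).
{ intros r hr; assert (V L <= V r).
  { apply (deriv_le0_decr V V1); [lra|intros; apply HV|]; intros; apply hV1; lra. }
  unfold profile; apply Rmult_le_pos; [nra|lra]. }
split.
- apply (radial_is_solution f F V V1); auto.
  + intros t; now apply lipschitz_continuous with K.
  + intros r hr; apply f_in; split; [apply hpos|apply hle]; lra.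
- intros r hr; apply hpos; lra.
Qed.

(** * Behaviour of non-negative solutions at the end points *)

(** This stands in for an initial condition at the singular point 0: the bound [C y] forces [g] to
    be at most 0 in the limit, and [g] decreases from there. *)
Lemma decr_from_zero (g dg : R -> R) C x : 0 < x ->
  (forall y, 0 < y <= x -> is_derive g y (dg y)) ->
  (forall y, 0 < y <= x -> dg y <= 0) ->
  (forall y, 0 < y <= x -> g y <= C * y) -> g x <= 0.
Proof.
intros hx hd hdg hg; apply Rnot_lt_le; intros hlt.
assert (hC : 0 < C) by (specialize (hg x ltac:(lra)); nra).
set (y := Rmin x (g x / (2 * C))).
assert (hq : 0 < g x / (2 * C)) by (apply Rdiv_lt_0_compat; lra).
assert (hy : 0 < y <= x).
{ split; [apply Rmin_pos; lra|apply Rmin_l]. }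
assert (h1 : g x <= g y).
{ apply (deriv_le0_decr g dg); [lra| |]; intros z hz; [apply hd|apply hdg]; lra. }
specialize (hg y hy).
assert (h2 : y <= g x / (2 * C)) by apply Rmin_r.
assert (C * y <= C * (g x / (2 * C))) by (apply Rmult_le_compat_l; lra).
replace (C * (g x / (2 * C))) with (g x / 2) in H by (field; lra); lra.
Qed.

Lemma at_left_eps (g : R -> R) x l : filterlim g (at_left x) (locally l) ->
  forall e, 0 < e -> exists d, 0 < d /\ forall y, x - d < y < x -> Rabs (g y - l) < e.
Proof.
intros H e he; destruct (proj1 (filterlim_locally g l) H (mkposreal e he)) as [d hd].
exists d; split; [apply cond_pos|]; intros y hy; apply hd; [|lra].
change (Rabs (y - x) < d); apply Rabs_def1; lra.
Qed.

Lemma at_right_eps (g : R -> R) x l : filterlim g (at_right x) (locally l) ->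
  forall e, 0 < e -> exists d, 0 < d /\ forall y, x < y < x + d -> Rabs (g y - l) < e.
Proof.
intros H e he; destruct (proj1 (filterlim_locally g l) H (mkposreal e he)) as [d hd].
exists d; split; [apply cond_pos|]; intros y hy; apply hd; [|lra].
change (Rabs (y - x) < d); apply Rabs_def1; lra.
Qed.

Lemma solution_derive F L s v r : is_solution F L s v -> 0 < r < L ->
  is_derive v r (Derive v r) /\ is_derive (Derive v) r (Derive_n v 2 r).
Proof.
intros [hC _] hr; destruct (hC r hr) as [h _]; split; apply Derive_correct.
- apply (h 1%nat); lia.
- apply (ex_derive_ext (Derive_n v 1)); [reflexivity|apply (h 2%nat); lia].
Qed.

Definition extension (g : R -> R) (L l0 l1 r : R) : R :=
  if Rle_dec r 0 then l0 else if Rlt_dec r L then g r else l1.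

Lemma extension_in g L l0 l1 r : 0 < r < L -> extension g L l0 l1 r = g r.
Proof. intros h; unfold extension; now destruct (Rle_dec r 0), (Rlt_dec r L); try lra. Qed.

Lemma extension_0 g L l0 l1 : extension g L l0 l1 0 = l0.
Proof. unfold extension; now destruct (Rle_dec 0 0); try lra. Qed.

Lemma extension_end g L l0 l1 : 0 < L -> extension g L l0 l1 L = l1.
Proof. intros; unfold extension; now destruct (Rle_dec L 0), (Rlt_dec L L); try lra. Qed.

Lemma extension_continuous g L l0 l1 : 0 < L -> (forall r, 0 < r < L -> continuous g r) ->
  filterlim g (at_right 0) (locally l0) -> filterlim g (at_left L) (locally l1) ->
  forall r, 0 <= r <= L -> continuous (extension g L l0 l1) r.
Proof.
intros hL hg h0 h1 r hr; destruct (Req_dec r 0) as [->|n0]; [|destruct (Req_dec r L) as [->|n1]].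
- apply continuity_pt_filterlim; intros e he.
  destruct (at_right_eps _ _ _ h0 e he) as [d [hd hd']].
  exists (Rmin d L); split; [apply Rmin_pos; lra|]; intros y [_ hy]; simpl in *; unfold R_dist in *.
  rewrite extension_0; rewrite Rminus_0_r in hy.
  assert (Rabs y < d) by (apply Rlt_le_trans with (1 := hy), Rmin_l).
  assert (Rabs y < L) by (apply Rlt_le_trans with (1 := hy), Rmin_r).
  destruct (Rle_lt_dec y 0) as [hn|hp].
  + unfold extension; destruct (Rle_dec y 0); [|lra]; rewrite Rminus_diag, Rabs_R0; lra.
  + rewrite Rabs_pos_eq in * by lra; rewrite extension_in by lra; apply hd'; lra.
- apply continuity_pt_filterlim; intros e he.
  destruct (at_left_eps _ _ _ h1 e he) as [d [hd hd']].
  exists (Rmin d L); split; [apply Rmin_pos; lra|]; intros y [_ hy]; simpl in *; unfold R_dist in *.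
  rewrite extension_end by exact hL.
  assert (ha : Rabs (y - L) < d) by (apply Rlt_le_trans with (1 := hy), Rmin_l).
  assert (hb : Rabs (y - L) < L) by (apply Rlt_le_trans with (1 := hy), Rmin_r).
  apply Rabs_def2 in ha; apply Rabs_def2 in hb.
  destruct (Rlt_le_dec y L) as [hn|hp].
  + rewrite extension_in by lra; apply hd'; lra.
  + unfold extension; destruct (Rle_dec y 0), (Rlt_dec y L); try lra.
    rewrite Rminus_diag, Rabs_R0; lra.
- apply (continuous_ext_loc _ g); [|apply hg; lra].
  assert (h : locally r (fun y => 0 < y /\ y < L)).
  { apply filter_and; [apply (open_gt 0 r); lra|apply (open_lt L r); lra]. }
  apply filter_imp with (2 := h); intros; symmetry; now apply extension_in.
Qed.

(** At an interior maximum with [v >= s] the equation gives [v'' = 6 v / r^2 + F v > 0]. If the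
    extension is maximal at [L], then any [r] with [v r >= s] is itself an interior maximum. *)
Lemma nonneg_solution_lt F L s v : 0 < L -> 0 < s -> F s = 0 ->
  (forall t, s < t -> 0 <= F t) -> is_solution F L s v ->
  forall r, 0 < r < L -> v r < s.
Proof.
intros hL hs Fs hF hv r hr; apply Rnot_le_lt; intros hle.
assert (hder := fun r h => solution_derive F L s v r hv h).
destruct hv as [_ [hode [h0 h1]]].
set (w := extension v L 0 s).
assert (w_in : forall r, 0 < r < L -> w r = v r) by (intros; now apply extension_in).
destruct (exists_max w 0 L ltac:(lra)) as [m [hm hmax]].
{ apply extension_continuous; auto.
  intros y hy; apply is_derive_cont with (Derive v y); now apply hder. }
assert (hx : exists x, 0 < x < L /\ s <= v x /\ forall y, 0 < y < L -> v y <= v x).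
{ assert (hmr := hmax r ltac:(lra)); rewrite w_in in hmr by exact hr.
  destruct (Req_dec m 0) as [->|n0]; [unfold w in hmr; rewrite extension_0 in hmr; lra|].
  destruct (Req_dec m L) as [->|n1].
  - unfold w in hmr; rewrite extension_end in hmr by exact hL.
    exists r; repeat split; try lra; intros y hy.
    assert (hmy := hmax y ltac:(lra)); rewrite w_in in hmy by exact hy.
    unfold w in hmy; rewrite extension_end in hmy by exact hL; lra.
  - rewrite w_in in hmr by lra; exists m; repeat split; try lra; intros y hy.
    assert (hmy := hmax y ltac:(lra)); rewrite !w_in in hmy by lra; exact hmy. }
destruct hx as [x [hx [hxs hxm]]].
destruct (interior_max_second_derivative v (Derive v) x (Derive_n v 2 x) 0 L hx) as [e1 e2]; auto.
{ intros y hy; now apply hder. }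
{ now apply hder. }
assert (e := hode x hx); rewrite e1 in e.
assert (0 <= F (v x)).
{ destruct (Req_dec (v x) s) as [->|]; [lra|apply hF; lra]. }
assert (0 < 6 / x ^ 2 * v x).
{ apply Rmult_lt_0_compat; [apply Rdiv_lt_0_compat; [lra|apply pow_lt; lra]|lra]. }
lra.
Qed.

(** This is what sliding needs from a solution: [V] is extended to the whole line and is positive up
    to the origin included, whereas the equation is known only inside [(0, L)]. *)
Definition regular_profile (F : R -> R) (L s C : R) (V V1 : R -> R) : Prop :=
  0 <= C /\ lipschitz C V /\ V L = s / L ^ 2 /\
  (forall r, 0 <= r <= L -> 0 < V r) /\
  (forall r, 0 < r < L -> profile V r < s) /\
  (forall r, 0 < r < L -> is_derive V r (V1 r) /\
     is_derive (fun x => x ^ 6 * V1 x) r (source F V r) /\ Rabs (V1 r) <= C).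

Lemma small_inv p c x : 0 < p -> 0 < x -> exists y, 0 < y <= x /\ y <= 1 /\ c < p / y.
Proof.
intros hp hx; set (y := Rmin x (Rmin 1 (p / (Rabs c + 1)))).
assert (hc := Rabs_pos c); assert (hc' := Rle_abs c).
assert (hq : 0 < p / (Rabs c + 1)) by (apply Rdiv_lt_0_compat; lra).
assert (hy : 0 < y) by (unfold y; repeat apply Rmin_pos; lra).
assert (hy2 : y <= p / (Rabs c + 1)) by (unfold y; rewrite !Rmin_r; lra).
exists y; repeat split; [exact hy|apply Rmin_l| |].
- unfold y; rewrite Rmin_r; apply Rmin_l.
- apply (Rlt_div_r _ _ _ hy).
  apply Rle_lt_trans with (Rabs c * y); [nra|].
  assert (y * (Rabs c + 1) <= p); [|nra].
  replace p with (p / (Rabs c + 1) * (Rabs c + 1)) by (field; lra).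
  apply Rmult_le_compat_r; lra.
Qed.

Lemma inv_pow_ge y n : 0 < y <= 1 -> / y <= / y ^ S n.
Proof.
intros hy; apply Rinv_le_contravar; [apply pow_lt; lra|].
simpl; assert (y ^ n <= 1 ^ n) by (apply pow_incr; lra); rewrite pow1 in H.
assert (0 < y ^ n) by (apply pow_lt; lra); nra.
Qed.

Lemma monotone_lipschitz_extension (V : R -> R) L l C : 0 < L -> 0 <= C ->
  (forall x y, 0 < y <= x -> x < L -> V x <= V y <= V x + C * (x - y)) ->
  filterlim V (at_left L) (locally l) ->
  exists W, lipschitz C W /\ (forall r, 0 < r < L -> W r = V r) /\ W L = l /\
    forall r, 0 <= r <= L -> l <= W r.
Proof.
intros hL hC hV hl.
assert (hend : forall x, 0 < x < L -> l <= V x <= l + C * (L - x)).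
{ intros x hx; split; apply Rnot_lt_le; intros hlt.
  - destruct (at_left_eps _ _ _ hl (l - V x) ltac:(lra)) as [d [hd h]].
    set (y := Rmax x (L - d / 2)).
    assert (hy : x <= y < L /\ L - d < y) by (unfold y, Rmax; destruct (Rle_dec _ _); lra).
    specialize (h y ltac:(lra)); apply Rabs_def2 in h.
    generalize (hV y x ltac:(lra) ltac:(lra)); lra.
  - destruct (at_left_eps _ _ _ hl (V x - (l + C * (L - x))) ltac:(lra)) as [d [hd h]].
    set (y := Rmax x (L - d / 2)).
    assert (hy : x <= y < L /\ L - d < y) by (unfold y, Rmax; destruct (Rle_dec _ _); lra).
    specialize (h y ltac:(lra)); apply Rabs_def2 in h.
    assert (C * (y - x) <= C * (L - x)) by (apply Rmult_le_compat_l; lra).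
    generalize (hV y x ltac:(lra) ltac:(lra)); lra. }
(* As [V] decreases, its limit at 0 is the supremum of its values. *)
destruct (completeness (fun y => exists r, 0 < r < L /\ y = V r)) as [b [b1 b2]].
{ exists (l + C * L); intros y [r [hr ->]]; destruct (hend r hr) as [_ h].
  assert (C * (L - r) <= C * L) by (apply Rmult_le_compat_l; lra); lra. }
{ exists (V (L / 2)), (L / 2); split; [lra|reflexivity]. }
assert (hb : forall x, 0 < x < L -> V x <= b <= V x + C * x).
{ intros x hx; split; [apply b1; now exists x|].
  apply b2; intros y [r [hr ->]].
  assert (0 <= C * x) by (apply Rmult_le_pos; lra).
  assert (0 <= C * r) by (apply Rmult_le_pos; lra).
  destruct (Rle_lt_dec r x).
  - generalize (hV x r ltac:(lra) ltac:(lra)); lra.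
  - generalize (hV r x ltac:(lra) ltac:(lra)); lra. }
assert (hbl : l <= b <= l + C * L).
{ assert (h1 := hb (L / 2) ltac:(lra)); assert (h2 := hend (L / 2) ltac:(lra)); lra. }
set (W0 := extension V L b l).
assert (W0_in : forall r, 0 < r < L -> W0 r = V r) by (intros; now apply extension_in).
assert (hW0 : forall x y, 0 <= y <= x -> x <= L -> W0 x <= W0 y <= W0 x + C * (x - y)).
{ intros x y hy hx.
  destruct (Req_dec x y) as [->|hn]; [lra|].
  destruct (Req_dec y 0) as [->|hy0]; destruct (Req_dec x L) as [->|hx0].
  - unfold W0; rewrite extension_0, extension_end by exact hL; lra.
  - rewrite (W0_in x) by lra; unfold W0; rewrite extension_0.
    generalize (hb x ltac:(lra)); lra.
  - rewrite (W0_in y) by lra; unfold W0; rewrite extension_end by exact hL.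
    apply hend; lra.
  - rewrite !W0_in by lra; apply hV; lra. }
(* Clamping the argument to [[0, L]] turns the Lipschitz bound there into a global one. *)
exists (truncate W0 0 L); repeat split.
- apply truncate_lipschitz; try lra; intros x y hx hy.
  destruct (Rle_lt_dec x y).
  + generalize (hW0 y x ltac:(lra) ltac:(lra)); intros h.
    rewrite (Rabs_pos_eq (W0 x - W0 y)), (Rabs_left1 (x - y)) by lra; lra.
  + generalize (hW0 x y ltac:(lra) ltac:(lra)); intros h.
    rewrite (Rabs_left1 (W0 x - W0 y)), (Rabs_pos_eq (x - y)) by lra; lra.
- intros r hr; rewrite truncate_in by lra; now apply W0_in.
- rewrite truncate_in by lra; now apply extension_end.
- intros r hr; rewrite truncate_in by lra.
  replace l with (W0 L) by now apply extension_end.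
  apply hW0; lra.
Qed.

(** The boundary condition concerns only the limit of [v], while the homogeneous equation for [V]
    also has the mode [r^-5]. Once this mode is excluded, [V] decreases with bounded slope, so it
    extends to [[0, L]] with values at least [s / L^2]. *)
Lemma nonneg_solution_regular (F : R -> R) (L s : R) v :
  0 < L -> 0 < s -> class_C 1 (fun _ => True) F -> F 0 = 0 -> F s = 0 ->
  (forall t, 0 < t < s -> F t < 0) -> (forall t, s < t -> 0 <= F t) ->
  is_solution F L s v -> nonneg_on L v ->
  exists C V V1, regular_profile F L s C V V1 /\ forall r, 0 < r < L -> v r = profile V r.
Proof.
intros hL hs HF F0 Fs hneg hFpos hv hv0.
destruct (C1_lipschitz F 0 s HF ltac:(lra)) as [K [hK hlip]].
assert (hlt := nonneg_solution_lt F L s v hL hs Fs hFpos hv).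
assert (hder := fun r h => solution_derive F L s v r hv h).
destruct hv as [_ [hode [_ hvL]]].
assert (hvs : forall r, 0 < r < L -> 0 <= v r < s) by (intros; split; [apply hv0|apply hlt]; lra).
assert (hFK : forall t, 0 <= t <= s -> - (K * t) <= F t <= 0).
{ intros t ht; assert (h := hlip t 0 ht ltac:(lra)).
  rewrite F0, !Rminus_0_r, (Rabs_pos_eq t) in h by lra; apply Rabs_le_between in h.
  split; [lra|]; destruct (Req_dec t 0) as [->|]; [lra|].
  destruct (Req_dec t s) as [->|]; [lra|]; apply Rlt_le, hneg; lra. }
set (V := fun r => v r / r ^ 2).
set (V1 := fun r => Derive v r / r ^ 2 - 2 * v r / r ^ 3).
set (P := fun r => r ^ 6 * V1 r).
assert (hV : forall r, 0 < r < L -> is_derive V r (V1 r)).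
{ intros r hr; destruct (hder r hr) as [h1 _].
  replace (V1 r) with (Derive v r * / r ^ 2 + v r * (- (2 * r) / (r ^ 2) ^ 2))
    by (unfold V1; field; lra).
  apply (is_derive_mult (K := R_AbsRing) v (fun x => / x ^ 2)); [exact h1| |exact Rmult_comm].
  auto_derive; [nra|field; lra]. }
assert (hP : forall r, 0 < r < L -> is_derive P r (r ^ 4 * F (v r))).
{ intros r hr; destruct (hder r hr) as [h1 h2].
  apply (is_derive_ext_loc (fun r => r ^ 4 * Derive v r - 2 * r ^ 3 * v r)).
  { apply filter_imp with (2 := locally_pos r (proj1 hr)); intros x hx.
    unfold P, V1; assert (h : forall a b : R, x ^ 4 * a - 2 * x ^ 3 * b
      = x ^ 6 * (a / x ^ 2 - 2 * b / x ^ 3)) by (intros; field; lra); apply h. }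
  rewrite <- (hode r hr).
  replace (r ^ 4 * _) with ((4 * r ^ 3 * Derive v r + r ^ 4 * Derive_n v 2 r)
    - (6 * r ^ 2 * v r + 2 * r ^ 3 * Derive v r)) by (field; lra).
  apply (is_derive_minus (V := R_NormedModule)).
  - apply (is_derive_mult (K := R_AbsRing) (fun x => x ^ 4) (Derive v)); [|exact h2|exact Rmult_comm].
    auto_derive; trivial; simpl; ring.
  - apply (is_derive_mult (K := R_AbsRing) (fun x => 2 * x ^ 3) v); [|exact h1|exact Rmult_comm].
    auto_derive; trivial; simpl; ring. }
assert (hVv : forall r, 0 < r -> v r = r ^ 2 * V r) by (intros; unfold V; field; lra).
assert (hV0 : forall r, 0 < r < L -> 0 <= V r).
{ intros r hr; apply Rdiv_le_0_compat; [now apply hvs|apply pow_lt; lra]. }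
assert (hV1P : forall r, 0 < r -> V1 r = P r / r ^ 6) by (intros; unfold P; field; lra).
assert (hinv5 : forall c r, 0 < r -> is_derive (fun x => c * / x ^ 5) r (- (5 * c) / r ^ 6)).
{ intros c r hr; auto_derive; [|field; lra].
  repeat apply Rmult_integral_contrapositive_currified; lra. }
(* A positive value of [P] would make [V] of order [- r^-5] at the origin. *)
assert (hPneg : forall r, 0 < r < L -> P r <= 0).
{ intros r hr; apply Rnot_lt_le; intros hp.
  destruct (small_inv (P r / 5) (V r + P r / 5 * / r ^ 5) r ltac:(lra) ltac:(lra)) as [y [hy [hy1 hyc]]].
  assert (h : V y + P r / 5 * / y ^ 5 <= V r + P r / 5 * / r ^ 5).
  { apply (deriv_ge0_incr (fun x => V x + P r / 5 * / x ^ 5)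
      (fun x => V1 x + - (5 * (P r / 5)) / x ^ 6)); [lra| |].
    - intros x hx; apply (is_derive_plus (V := R_NormedModule)); [apply hV; lra|apply hinv5; lra].
    - intros x hx; rewrite hV1P by lra.
      replace (P x / x ^ 6 + - (5 * (P r / 5)) / x ^ 6) with ((P x - P r) * / x ^ 6) by (field; lra).
      apply Rmult_le_pos; [|apply Rlt_le, Rinv_0_lt_compat, pow_lt; lra].
      assert (P r <= P x); [|lra].
      apply (deriv_le0_decr P (fun x => x ^ 4 * F (v x))); [lra|intros; apply hP; lra|].
      intros z hz; assert (0 <= z ^ 4) by (apply pow_le; lra).
      generalize (hFK (v z) ltac:(generalize (hvs z ltac:(lra)); lra)); nra. }
  assert (h5 := inv_pow_ge y 4 ltac:(lra)); assert (h6 := hV0 y ltac:(lra)).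
  unfold Rdiv in hyc at 3; assert (P r / 5 * / y <= P r / 5 * / y ^ 5) by (apply Rmult_le_compat_l; lra).
  unfold Rdiv in *; lra. }
(* A negative limit of [P] would make [v = r^2 V] of order [r^-3] at the origin. *)
assert (hPlow : forall r, 0 < r < L -> - (K * s / 5 * r ^ 5) <= P r).
{ intros r hr; apply Rnot_lt_le; intros hp.
  set (p := - (P r + K * s / 5 * r ^ 5)).
  assert (hp0 : 0 < p) by (unfold p; lra).
  set (c := V r - p / 5 * / r ^ 5).
  destruct (small_inv (p / 5) (s + Rabs c) r ltac:(lra) ltac:(lra)) as [y [hy [hy1 hyc]]].
  assert (hPx : forall x, 0 < x <= r -> P x <= - p).
  { intros x hx.
    assert (h : P x + K * s / 5 * x ^ 5 <= P r + K * s / 5 * r ^ 5).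
    { apply (deriv_ge0_incr (fun x => P x + K * s / 5 * x ^ 5)
        (fun x => x ^ 4 * F (v x) + K * s * x ^ 4)); [lra| |].
      - intros z hz; apply (is_derive_plus (V := R_NormedModule) P); [apply hP; lra|].
        auto_derive; trivial; simpl; field.
      - intros z hz; assert (0 <= z ^ 4) by (apply pow_le; lra).
        assert (hz' := hvs z ltac:(lra)).
        assert (0 <= F (v z) + K * s); [|nra].
        assert (K * v z <= K * s) by (apply Rmult_le_compat_l; lra).
        generalize (hFK (v z) ltac:(lra)); lra. }
    assert (0 <= K * s / 5 * x ^ 5).
    { apply Rmult_le_pos; [|apply pow_le; lra]; apply Rdiv_le_0_compat; [|lra]; nra. }
    unfold p; lra. }
  assert (h : c <= V y - p / 5 * / y ^ 5).
  { apply (deriv_le0_decr (fun x => V x - p / 5 * / x ^ 5)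
      (fun x => V1 x - - (5 * (p / 5)) / x ^ 6)); [lra| |].
    - intros x hx; apply (is_derive_minus (V := R_NormedModule)); [apply hV; lra|apply hinv5; lra].
    - intros x hx; rewrite hV1P by lra.
      replace (P x / x ^ 6 - - (5 * (p / 5)) / x ^ 6) with (- ((- P x - p) * / x ^ 6)) by (field; lra).
      apply Ropp_le_cancel; rewrite Ropp_involutive, Ropp_0.
      apply Rmult_le_pos; [|apply Rlt_le, Rinv_0_lt_compat, pow_lt; lra].
      specialize (hPx x ltac:(lra)); lra. }
  assert (h3 := inv_pow_ge y 2 ltac:(lra)).
  assert (hvy := hVv y ltac:(lra)); assert (hvy' := hvs y ltac:(lra)).
  assert (hy2 : 0 < y ^ 2 <= 1) by (split; [apply pow_lt; lra|simpl; nra]).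
  assert (h4 : y ^ 2 * (c + p / 5 * / y ^ 5) <= v y).
  { rewrite hvy; apply Rmult_le_compat_l; lra. }
  replace (y ^ 2 * (c + p / 5 * / y ^ 5)) with (y ^ 2 * c + p / 5 * / y ^ 3) in h4 by (field; lra).
  assert (p / 5 * / y <= p / 5 * / y ^ 3) by (apply Rmult_le_compat_l; lra).
  assert (- Rabs c <= y ^ 2 * c).
  { generalize (Rabs_pos c) (Rle_abs (- c)); rewrite Rabs_Ropp; nra. }
  unfold Rdiv in hyc at 2; unfold Rdiv in *; lra. }
(* Two bootstrap steps: [v = O(r)], then [V' = O(1)]. *)
assert (hvr : exists C, 0 <= C /\ forall r, 0 < r < L -> v r <= C * r).
{ set (C := L / 2 * V (L / 2) + K * s / 5 * (L / 2)).
  assert (hC : 0 <= C).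
  { assert (h := hV0 (L / 2) ltac:(lra)); unfold C; apply Rplus_le_le_0_compat.
    - apply Rmult_le_pos; lra.
    - apply Rmult_le_pos; [apply Rdiv_le_0_compat; nra|lra]. }
  exists (C + s * (2 / L)).
  assert (hsL : 0 < s * (2 / L)) by (apply Rmult_lt_0_compat; [lra|apply Rdiv_lt_0_compat; lra]).
  split; [lra|]; intros r hr.
  assert (hl2 : 0 <= L / 2) by lra.
  destruct (Rle_lt_dec r (L / 2)) as [h|h].
  (* By [hPlow], [r V' = P / r^5 >= - K s / 5]. With [V >= 0] the left-hand side is nondecreasing in
     [r], so [r V = v / r] stays bounded on [(0, L / 2]]. *)
  - assert (h' : r * V r + K * s / 5 * r <= C).
    { apply (deriv_ge0_incr (fun x => x * V x + K * s / 5 * x)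
        (fun x => (1 * V x + x * V1 x) + K * s / 5)); [lra| |].
      - intros x hx; apply (is_derive_plus (V := R_NormedModule) (fun x => x * V x)).
        + apply (is_derive_mult (K := R_AbsRing) (fun x => x)); [|apply hV; lra|exact Rmult_comm].
          apply (is_derive_id (K := R_AbsRing)).
        + auto_derive; trivial; ring.
      - intros x hx; rewrite hV1P by lra.
        assert (h1 := hPlow x ltac:(lra)); assert (h2 := hV0 x ltac:(lra)).
        replace (x * (P x / x ^ 6)) with (P x * / x ^ 5) by (field; lra).
        assert (h3 : - (K * s / 5) <= P x * / x ^ 5); [|lra].
        replace (- (K * s / 5)) with (- (K * s / 5 * x ^ 5) * / x ^ 5) by (field; lra).
        apply Rmult_le_compat_r; [apply Rlt_le, Rinv_0_lt_compat, pow_lt; lra|exact h1]. }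
    rewrite hVv by lra.
    assert (0 <= K * s / 5 * r) by (apply Rmult_le_pos; [apply Rdiv_le_0_compat; nra|lra]).
    nra.
  - assert (h1 := hvs r hr).
    assert (s * (2 / L) * (L / 2) <= s * (2 / L) * r) by (apply Rmult_le_compat_l; lra).
    replace (s * (2 / L) * (L / 2)) with s in H by (field; lra); nra. }
destruct hvr as [C2 [hC2 hvr]].
set (C := K * C2 / 6).
assert (hKC : 0 <= K * C2) by (apply Rmult_le_pos; lra).
assert (hC : 0 <= C) by (unfold C; lra).
assert (hV1C : forall r, 0 < r < L -> - C <= V1 r <= 0).
{ intros r hr; assert (h6 : 0 < r ^ 6) by (apply pow_lt; lra).
  (* With [v <= C2 r] the source is at least [- K C2 r^5]. It is integrated from 0, where [hPlow]
     gives the starting value. *)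
  assert (hl : - (P r + C * r ^ 6) <= 0).
  { apply (decr_from_zero (fun x => - (P x + C * x ^ 6))
      (fun x => - (x ^ 4 * F (v x) + K * C2 * x ^ 5)) (K * s / 5 * L ^ 4) r); [lra| | |].
    - intros y hy; apply (is_derive_opp (V := R_NormedModule) (fun x => P x + C * x ^ 6)).
      apply (is_derive_plus (V := R_NormedModule) P); [apply hP; lra|].
      unfold C; auto_derive; trivial; simpl; field.
    - intros y hy; assert (h1 := hvr y ltac:(lra)); assert (h2 := hvs y ltac:(lra)).
      assert (h3 := hFK (v y) ltac:(lra)).
      replace (y ^ 4 * F (v y) + K * C2 * y ^ 5) with (y ^ 4 * (F (v y) + K * (C2 * y))) by ring.
      assert (0 <= y ^ 4) by (apply pow_le; lra).
      assert (K * v y <= K * (C2 * y)) by (apply Rmult_le_compat_l; lra).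
      assert (0 <= y ^ 4 * (F (v y) + K * (C2 * y))) by (apply Rmult_le_pos; lra); lra.
    - intros y hy; assert (h1 := hPlow y ltac:(lra)).
      assert (0 <= C * y ^ 6) by (apply Rmult_le_pos; [lra|apply pow_le; lra]).
      assert (h4 : y ^ 4 <= L ^ 4) by (apply pow_incr; lra).
      assert (K * s / 5 * (y ^ 4 * y) <= K * s / 5 * (L ^ 4 * y)).
      { apply Rmult_le_compat_l; [apply Rdiv_le_0_compat; nra|]; apply Rmult_le_compat_r; lra. }
      replace (y ^ 5) with (y ^ 4 * y) in h1 by ring; lra. }
  specialize (hPneg r hr); unfold P in *; split; nra. }
assert (hmono : forall x y, 0 < y <= x -> x < L -> V x <= V y <= V x + C * (x - y)).
{ intros x y hy hx.
  destruct (mean_value V V1 y x ltac:(lra)) as [c [hc e]]; [intros; apply hV; lra|].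
  specialize (hV1C c ltac:(lra)); nra. }
assert (hlim : filterlim V (at_left L) (locally (s / L ^ 2))).
{ apply (filterlim_comp_2 (G := locally s) (H := locally (/ L ^ 2))
    v (fun x => / x ^ 2) Rmult); [exact hvL| |apply (filterlim_mult (K := R_AbsRing))].
  assert (h : continuous (fun x => / x ^ 2) L).
  { apply (ex_derive_continuous (V := R_NormedModule)); auto_derive; nra. }
  apply filterlim_filter_le_1 with (2 := h).
  intros Q [e he]; exists e; intros y hy _; now apply he. }
destruct (monotone_lipschitz_extension V L (s / L ^ 2) C hL hC hmono hlim)
  as [W [W1 [W2 [W3 W4]]]].
assert (hsL : 0 < s / L ^ 2) by (apply Rdiv_lt_0_compat; [lra|now apply pow_lt]).
exists C, W, V1; split.
- do 3 (split; [assumption|]); split; [|split].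
  + intros r hr; specialize (W4 r hr); lra.
  + intros r hr; unfold profile; rewrite W2, <- hVv by lra; now apply hlt.
  + intros r hr; split; [|split].
    * apply (is_derive_ext_loc V); [|now apply hV].
      assert (h : locally r (fun y => 0 < y /\ y < L)).
      { apply filter_and; [apply (open_gt 0 r); lra|apply (open_lt L r); lra]. }
      apply filter_imp with (2 := h); intros; symmetry; now apply W2.
    * unfold source; rewrite W2, <- hVv by lra; now apply hP.
    * apply Rabs_le; generalize (hV1C r hr); lra.
- intros r hr; unfold profile; rewrite W2 by exact hr; apply hVv; lra.
Qed.

(** * Uniqueness by sliding *)

(* [gap lam x >= 0] says that [r |-> lam^2 V (lam r)], the profile of [u (lam r)],
   lies above [W] at [r = x / lam]. *)
Definition gap (V W : R -> R) (lam x : R) : R := lam ^ 2 * V x - W (x / lam).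

Lemma div_lt a b c : 0 < c -> a < b * c -> a / c < b.
Proof. intros hc; apply (proj2 (Rlt_div_l a b c hc)). Qed.

Section Sliding.
Variables (F : R -> R) (L s C1 C2 K : R) (V V1 W W1 : R -> R).
Hypotheses (hL : 0 < L) (hK : 0 < K)
  (hlip : forall x y, 0 <= x <= s -> 0 <= y <= s -> Rabs (F x - F y) <= K * Rabs (x - y))
  (hneg : forall t, 0 < t < s -> F t < 0)
  (hV : regular_profile F L s C1 V V1) (hW : regular_profile F L s C2 W W1).

Lemma div_in lam x : 1 <= lam -> 0 < x < L -> 0 < x / lam < L.
Proof.
intros hl hx; split; [apply Rdiv_lt_0_compat; lra|].
apply div_lt; nra.
Qed.

Definition gap1 (lam x : R) : R := lam ^ 2 * V1 x - / lam * W1 (x / lam).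

Lemma gap_derive lam x : 1 <= lam -> 0 < x < L -> is_derive (gap V W lam) x (gap1 lam x).
Proof.
intros hl hx; destruct hV as [_ [_ [_ [_ [_ h1]]]]]; destruct hW as [_ [_ [_ [_ [_ h2]]]]].
apply (is_derive_minus (V := R_NormedModule)).
- apply is_derive_scal, h1, hx.
- apply (is_derive_comp (V := R_NormedModule) W (fun x => x / lam)).
  + apply h2, div_in; auto.
  + auto_derive; trivial; field; lra.
Qed.

Lemma gap_flux_derive lam x : 1 <= lam -> 0 < x < L ->
  is_derive (fun x => x ^ 6 * gap1 lam x) x
    (x ^ 4 * (lam ^ 2 * F (profile V x) - F (profile W (x / lam)))).
Proof.
intros hl hx; destruct hV as [_ [_ [_ [_ [_ h1]]]]]; destruct hW as [_ [_ [_ [_ [_ h2]]]]].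
apply (is_derive_ext (fun x => lam ^ 2 * (x ^ 6 * V1 x) - lam ^ 5 * ((x / lam) ^ 6 * W1 (x / lam)))).
{ intros y; unfold gap1.
  assert (h : forall a b : R, lam ^ 2 * (y ^ 6 * a) - lam ^ 5 * ((y / lam) ^ 6 * b)
    = y ^ 6 * (lam ^ 2 * a - / lam * b)) by (intros; field; lra).
  apply h. }
replace (x ^ 4 * _) with (lam ^ 2 * source F V x - lam ^ 5 * (/ lam * source F W (x / lam)))
  by (unfold source, profile; field; lra).
apply (is_derive_minus (V := R_NormedModule)).
- apply is_derive_scal, h1, hx.
- apply is_derive_scal.
  apply (is_derive_comp (V := R_NormedModule) (fun x => x ^ 6 * W1 x) (fun x => x / lam)).
  + apply h2, div_in; auto.
  + auto_derive; trivial; field; lra.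
Qed.

Lemma gap_continuous lam x : 1 <= lam -> continuous (gap V W lam) x.
Proof.
intros hl; destruct hV as [_ [l1 _]]; destruct hW as [_ [l2 _]].
apply (continuous_minus (V := R_NormedModule)).
- apply (continuous_mult (K := R_AbsRing)); [apply continuous_const|].
  now apply lipschitz_continuous with C1.
- apply (continuous_comp (fun x => x / lam) W); [|now apply lipschitz_continuous with C2].
  apply (ex_derive_continuous (V := R_NormedModule)); auto_derive; trivial.
Qed.

Lemma gap_continuous_scale lam x : 1 <= lam -> continuous (fun l => gap V W l x) lam.
Proof.
intros hl; destruct hW as [_ [l2 _]].
apply (continuous_minus (V := R_NormedModule)).
- apply (continuous_mult (K := R_AbsRing) (fun l => l ^ 2) (fun _ => V x)); [|apply continuous_const].
  apply (ex_derive_continuous (V := R_NormedModule)); auto_derive; trivial.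
- apply (continuous_comp (fun l => x / l) W); [|now apply lipschitz_continuous with C2].
  apply (ex_derive_continuous (V := R_NormedModule)); auto_derive; lra.
Qed.

(** At [x = L] the first solution has reached [s], while the second is evaluated at [L / lam < L],
    where it is still below [s]. *)
Lemma gap_end_pos lam : 1 < lam -> 0 < gap V W lam L.
Proof.
intros hl; destruct hV as [_ [_ [e _]]]; destruct hW as [_ [_ [_ [_ [h _]]]]].
assert (hd : 0 < L / lam < L).
{ split; [apply Rdiv_lt_0_compat; lra|]; apply div_lt; nra. }
specialize (h _ hd); unfold profile in h; unfold gap; rewrite e.
assert (hp : 0 < (L / lam) ^ 2) by (apply pow_lt; lra).
apply Rmult_lt_reg_l with (1 := hp).
replace ((L / lam) ^ 2 * (lam ^ 2 * (s / L ^ 2) - W (L / lam)))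
  with (s - (L / lam) ^ 2 * W (L / lam)) by (field; lra).
lra.
Qed.

(** Contact would be a minimum of the gap at which both profiles agree; then
    [x^2 gap'' = (lam^2 - 1) F(u) < 0]. *)
Lemma no_interior_contact lam x : 1 < lam -> 0 < x < L ->
  (forall y, 0 <= y <= L -> 0 <= gap V W lam y) -> gap V W lam x <> 0.
Proof.
intros hl hx hge h0.
(* [flux_derive] depends only on the source at the point [x], so the right-hand side of the gap
   equation is passed as a constant nonlinearity. *)
assert (hloc : is_derive (gap1 lam) x
  ((fun t => lam ^ 2 * F (profile V x) - F (profile W (x / lam))) (x ^ 2 * gap1 lam x) / x ^ 2
   - 6 * gap1 lam x / x)).
{ apply (flux_derive (fun _ => lam ^ 2 * F (profile V x) - F (profile W (x / lam))) (gap1 lam)); [lra|].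
  unfold source; apply gap_flux_derive; lra. }
cbv beta in hloc.
destruct (interior_max_second_derivative (fun y => - gap V W lam y) (fun y => - gap1 lam y) x
  (- ((lam ^ 2 * F (profile V x) - F (profile W (x / lam))) / x ^ 2 - 6 * gap1 lam x / x)) 0 L hx)
  as [e1 e2].
- intros y hy; apply (is_derive_opp (V := R_NormedModule)), gap_derive; lra.
- now apply (is_derive_opp (V := R_NormedModule)).
- intros y hy; specialize (hge y ltac:(lra)); lra.
- assert (e3 : gap1 lam x = 0) by lra; rewrite e3 in e2.
  assert (e4 : profile W (x / lam) = profile V x).
  { unfold profile; unfold gap in h0; replace (W (x / lam)) with (lam ^ 2 * V x) by lra.
    field; lra. }
  rewrite e4 in e2.
  destruct hV as [_ [_ [_ [hp [hlt _]]]]].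
  assert (hF : F (profile V x) < 0).
  { apply hneg; split; [|now apply hlt].
    unfold profile; apply Rmult_lt_0_compat; [apply pow_lt; lra|apply hp; lra]. }
  assert (hx2 : 0 < / x ^ 2) by (apply Rinv_0_lt_compat, pow_lt; lra).
  unfold Rdiv in e2.
  assert (0 < (lam ^ 2 - 1) * - F (profile V x)) by (apply Rmult_lt_0_compat; simpl; nra).
  assert (0 < (lam ^ 2 - 1) * - F (profile V x) * / x ^ 2) by (apply Rmult_lt_0_compat; lra).
  lra.
Qed.

(** The origin is a singular end point, so a Gronwall argument is used. If the gap vanished at 0 and
    had maximum [D > 0] on [[0, d]], its derivative would be at most [K D x / 7], and integration
    would give [D < D]. Hence the gap would vanish at [d], an interior contact. *)
Lemma no_contact_at_0 lam : 1 < lam ->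
  (forall y, 0 <= y <= L -> 0 <= gap V W lam y) -> gap V W lam 0 <> 0.
Proof.
intros hl hge h0.
assert (hc := fun x => gap_continuous lam x ltac:(lra)).
set (d := Rmin (L / 2) (/ (K + 1))).
assert (hd : 0 < d /\ d <= L / 2).
{ split; [apply Rmin_pos; [lra|apply Rinv_0_lt_compat; lra]|apply Rmin_l]. }
assert (hKd : K * d < 1).
{ assert (d <= / (K + 1)) by apply Rmin_r.
  apply Rle_lt_trans with (K * / (K + 1)); [apply Rmult_le_compat_l; lra|].
  apply div_lt; lra. }
assert (hd1 : d < 1).
{ apply Rle_lt_trans with (/ (K + 1)); [apply Rmin_r|].
  rewrite <- Rinv_1; apply Rinv_lt_contravar; lra. }
destruct (exists_max (gap V W lam) 0 d ltac:(lra)) as [m [hm hmax]]; [intros; apply hc|].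
apply (no_interior_contact lam d hl ltac:(lra) hge).
assert (hm0 : gap V W lam m <= 0).
{ apply Rnot_lt_le; intros hpos; set (D := gap V W lam m) in *.
  assert (hVW := (hV, hW)); destruct hVW as [[k1 [l1 [_ [p1 [q1 b1]]]]] [k2 [l2 [_ [p2 [q2 b2]]]]]].
  set (C := lam ^ 2 * C1 + C2).
  assert (hl2 : 1 < lam ^ 2) by (simpl; nra).
  assert (hil : 0 < / lam < 1).
  { split; [apply Rinv_0_lt_compat; lra|rewrite <- Rinv_1; apply Rinv_lt_contravar; lra]. }
  assert (hC : 0 <= C) by (unfold C; nra).
  assert (hsmall : forall x, 0 < x <= d -> 0 < profile V x < s /\ 0 < profile W (x / lam) < s).
  { intros x hx; assert (hxl := div_in lam x ltac:(lra) ltac:(lra)).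
    unfold profile at 1 3; repeat split; try (apply q1 || apply q2; lra).
    - apply Rmult_lt_0_compat; [apply pow_lt; lra|apply p1; lra].
    - apply Rmult_lt_0_compat; [apply pow_lt; lra|apply p2; lra]. }
  assert (hg1 : forall x, 0 < x <= d -> gap1 lam x <= K * D / 7 * x).
  { intros x hx; assert (hx6 : 0 < x ^ 6) by (apply pow_lt; lra).
    assert (hP : x ^ 6 * gap1 lam x - K * D / 7 * x ^ 7 <= 0).
    { apply (decr_from_zero (fun x => x ^ 6 * gap1 lam x - K * D / 7 * x ^ 7)
        (fun x => x ^ 4 * (lam ^ 2 * F (profile V x) - F (profile W (x / lam))) - K * D * x ^ 6)
        C x); [lra| | |].
      - intros y hy; apply (is_derive_minus (V := R_NormedModule) (fun x => x ^ 6 * gap1 lam x)).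
        + apply gap_flux_derive; lra.
        + auto_derive; trivial; simpl; field.
      - intros y hy; destruct (hsmall y ltac:(lra)) as [s1 s2].
        assert (hF := hneg _ s1).
        assert (hlp := hlip (profile V y) (profile W (y / lam)) ltac:(lra) ltac:(lra)).
        assert (e : profile V y - profile W (y / lam) = y ^ 2 * / lam ^ 2 * gap V W lam y).
        { unfold profile, gap; field; lra. }
        assert (hgy := hge y ltac:(lra)); assert (hgm := hmax y ltac:(lra)).
        assert (hy2 : 0 < y ^ 2) by (apply pow_lt; lra).
        assert (hi2 : 0 < / lam ^ 2 < 1).
        { split; [apply Rinv_0_lt_compat; lra|rewrite <- Rinv_1; apply Rinv_lt_contravar; lra]. }
        assert (hle : y ^ 2 * / lam ^ 2 * gap V W lam y <= y ^ 2 * D).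
        { rewrite Rmult_assoc; apply Rmult_le_compat_l; [lra|]; nra. }
        assert (hnn : 0 <= y ^ 2 * / lam ^ 2 * gap V W lam y).
        { apply Rmult_le_pos; [apply Rmult_le_pos; lra|lra]. }
        rewrite e, (Rabs_pos_eq (y ^ 2 * _ * _)) in hlp by exact hnn.
        assert (hl' := Rle_trans _ _ _ (Rle_abs _) hlp).
        (* Since [F < 0] at this value, the factor [lam^2 > 1] only helps, and the Lipschitz bound
           applies to what is left. *)
        assert (lam ^ 2 * F (profile V y) - F (profile W (y / lam)) <= K * (y ^ 2 * D)) by nra.
        replace (K * D * y ^ 6) with (y ^ 4 * (K * (y ^ 2 * D))) by ring.
        assert (0 <= y ^ 4) by (apply pow_le; lra); nra.
      - intros y hy.
        assert (hg : gap1 lam y <= C).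
        { destruct (b1 y ltac:(lra)) as [_ [_ a1]].
          destruct (b2 (y / lam)) as [_ [_ a2]]; [apply div_in; lra|].
          apply Rabs_le_between in a1; apply Rabs_le_between in a2; unfold gap1, C; nra. }
        assert (0 <= K * D / 7 * y ^ 7).
        { apply Rmult_le_pos; [nra|apply pow_le; lra]. }
        assert (h5 : y ^ 5 <= 1 ^ 5) by (apply pow_incr; lra); rewrite pow1 in h5.
        assert (h6 : 0 < y ^ 6 <= y).
        { split; [apply pow_lt; lra|]; replace (y ^ 6) with (y * y ^ 5) by ring; nra. }
        nra. }
    apply Rmult_le_reg_l with (1 := hx6); lra. }
  destruct (Req_dec m 0) as [e|hm1]; [unfold D in hpos; rewrite e, h0 in hpos; lra|].
  assert (hfin : D - K * D / 7 * d * m <= 0).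
  { apply (decr_from_zero (fun x => gap V W lam x - K * D / 7 * d * x)
      (fun x => gap1 lam x - K * D / 7 * d) C m); [lra| | |].
    - intros y hy; apply (is_derive_minus (V := R_NormedModule)); [apply gap_derive; lra|].
      auto_derive; trivial; ring.
    - intros y hy; specialize (hg1 y ltac:(lra)).
      assert (K * D / 7 * y <= K * D / 7 * d) by (apply Rmult_le_compat_l; nra); lra.
    - intros y hy; assert (0 <= K * D / 7 * d * y) by (apply Rmult_le_pos; [apply Rmult_le_pos; nra|lra]).
      assert (hg : gap V W lam y <= C * y); [|lra].
      rewrite <- (Rminus_0_r (gap V W lam y)), <- h0; unfold gap.
      replace (0 / lam) with 0 by (field; lra).
      assert (a1 := l1 y 0); assert (a2 := l2 (y / lam) 0).
      assert (hyl := div_in lam y ltac:(lra) ltac:(lra)).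
      rewrite !Rminus_0_r, (Rabs_pos_eq y) in a1 by lra.
      rewrite !Rminus_0_r, (Rabs_pos_eq (y / lam)) in a2 by lra.
      apply Rabs_le_between in a1; apply Rabs_le_between in a2.
      assert (C2 * (y / lam) <= C2 * y) by (apply Rmult_le_compat_l; unfold Rdiv; nra).
      unfold C; nra. }
  assert (K * d * m < 1) by nra.
  nra. }
specialize (hmax d ltac:(lra)); specialize (hge d ltac:(lra)); lra.
Qed.

(** Large [lam] are admissible because [V] has a positive minimum on [[0, L]]. If the infimum of
    admissible [lam] exceeded 1, the gap there would have a positive minimum and [lam] could be
    lowered further. *)
Lemma sliding_le x : 0 <= x <= L -> W x <= V x.
Proof.
assert (hVW := (hV, hW)); destruct hVW as [[k1 [l1 [_ [p1 [q1 b1]]]]] [k2 [l2 [_ [p2 [q2 b2]]]]]].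
set (S := fun lam => 1 <= lam /\ forall x, 0 <= x <= L -> 0 <= gap V W lam x).
destruct (exists_max (fun x => - V x) 0 L ltac:(lra)) as [m [hm hmin]].
{ intros y _; apply (continuous_opp (V := R_NormedModule)); now apply lipschitz_continuous with C1. }
destruct (exists_max V 0 L ltac:(lra)) as [M [hM hmax]].
{ intros y _; now apply lipschitz_continuous with C1. }
destruct (exists_max W 0 L ltac:(lra)) as [M2 [hM2 hmax2]].
{ intros y _; now apply lipschitz_continuous with C2. }
assert (hdiv : forall lam y, 1 <= lam -> 0 <= y <= L -> 0 <= y / lam <= L).
{ intros lam y hl hy; split; [apply Rdiv_le_0_compat; lra|].
  apply (proj2 (Rle_div_l y L lam ltac:(lra))); nra. }
assert (hS0 : exists lam, S lam).
{ exists (1 + W M2 / V m); assert (a1 := p1 m hm); assert (a2 := p2 M2 hM2).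
  assert (a3 : 0 < W M2 / V m) by (apply Rdiv_lt_0_compat; lra).
  split; [lra|]; intros y hy; unfold gap.
  assert (a4 := hmin y hy); assert (a5 := hmax2 _ (hdiv (1 + W M2 / V m) y ltac:(lra) hy)).
  assert (a6 : W M2 <= (1 + W M2 / V m) ^ 2 * V y); [|lra].
  apply Rle_trans with (W M2 / V m * V m); [apply Req_le; field; lra|].
  apply Rmult_le_compat; simpl; nra. }
(* The infimum of [S] is obtained as minus a supremum. *)
destruct (completeness (fun y => S (- y))) as [b [c1 c2]].
{ exists (- 1); intros y [h _]; lra. }
{ destruct hS0 as [lam h]; exists (- lam); now rewrite Ropp_involutive. }
set (lam := - b).
assert (hlow : forall l, S l -> lam <= l).
{ intros l h; unfold lam; assert (- l <= b); [|lra].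
  apply c1; now rewrite Ropp_involutive. }
assert (hlam : 1 <= lam).
{ unfold lam; assert (b <= - 1); [|lra]; apply c2; intros y [h _]; lra. }
assert (hS : S lam).
{ split; [exact hlam|]; intros y hy; apply Rnot_lt_le; intros hn.
  destruct (continuous_pos_near (fun l => - gap V W l y) lam) as [d [hd h]].
  - apply (continuous_opp (V := R_NormedModule) (fun l => gap V W l y)).
    now apply gap_continuous_scale.
  - lra.
  - assert (b <= - (lam + d / 2)); [|unfold lam in *; lra].
    apply c2; intros z hz; apply Rnot_lt_le; intros hlt.
    assert (h1 := hlow _ hz).
    specialize (h (- z) ltac:(apply Rabs_def1; lra)).
    destruct hz as [_ hz]; specialize (hz y hy); lra. }
destruct (Req_dec lam 1) as [e|hn].
{ intros hx; destruct hS as [_ hS]; specialize (hS x hx); rewrite e in hS; unfold gap in hS.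
  rewrite Rdiv_1_r in hS; lra. }
exfalso; destruct hS as [_ hS].
destruct (exists_max (fun x => - gap V W lam x) 0 L ltac:(lra)) as [z [hz hzmin]].
{ intros y _; apply (continuous_opp (V := R_NormedModule) (gap V W lam)).
  now apply gap_continuous. }
assert (hgz : 0 < gap V W lam z).
{ destruct (Req_dec z 0) as [->|n0]; [|destruct (Req_dec z L) as [->|n1]].
  - generalize (hS 0 ltac:(lra)) (no_contact_at_0 lam ltac:(lra) hS); lra.
  - apply gap_end_pos; lra.
  - generalize (hS z ltac:(lra)) (no_interior_contact lam z ltac:(lra) ltac:(lra) hS); lra. }
(* [Q] bounds the loss of the gap per unit decrease of [lam]: [2 lam V M] from the factor [lam^2],
   [C2 L] from the shifted argument of [W]. *)
set (Q := 2 * lam * V M + C2 * L + 1).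
assert (hVM := p1 M hM).
assert (hQ : 0 < Q) by (unfold Q; assert (0 <= C2 * L) by (apply Rmult_le_pos; lra); nra).
set (e := Rmin (lam - 1) (gap V W lam z / Q)).
assert (hq : 0 < gap V W lam z / Q) by (apply Rdiv_lt_0_compat; lra).
assert (he : 0 < e <= lam - 1) by (split; [apply Rmin_pos; lra|apply Rmin_l]).
assert (heQ : e * Q <= gap V W lam z).
{ apply (proj2 (Rle_div_r e (gap V W lam z) Q ltac:(lra))), Rmin_r. }
assert (h : S (lam - e)); [|generalize (hlow _ h); lra].
split; [lra|]; intros y hy; specialize (hzmin y hy); simpl in hzmin.
assert (a1 := hmax y hy); assert (a2 := p1 y hy).
assert (a3 := l2 (y / (lam - e)) (y / lam)).
replace (y / (lam - e) - y / lam) with (y * (e * / (lam * (lam - e)))) in a3 by (field; lra).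
assert (a4 : 0 < / (lam * (lam - e)) <= 1).
{ split; [apply Rinv_0_lt_compat; nra|rewrite <- Rinv_1; apply Rinv_le_contravar; nra]. }
assert (a5 : 0 <= e * / (lam * (lam - e)) <= e) by nra.
rewrite (Rabs_pos_eq (y * _)) in a3 by (apply Rmult_le_pos; lra).
assert (a6 : C2 * (y * (e * / (lam * (lam - e)))) <= C2 * (L * e)).
{ apply Rmult_le_compat_l; [lra|]; apply Rmult_le_compat; lra. }
apply Rabs_le_between in a3.
assert (a7 : (lam ^ 2 - (lam - e) ^ 2) * V y <= (2 * lam * e) * V M).
{ apply Rmult_le_compat; simpl; nra. }
unfold gap, Q in *; lra.
Qed.

End Sliding.

Lemma nonneg_solution_unique (F : R -> R) (L s : R) u v :
  0 < L -> 0 < s -> class_C 1 (fun _ => True) F -> F 0 = 0 -> F s = 0 ->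
  (forall t, 0 < t < s -> F t < 0) -> (forall t, s < t -> 0 <= F t) ->
  is_solution F L s u -> nonneg_on L u -> is_solution F L s v -> nonneg_on L v ->
  forall r, 0 < r < L -> v r = u r.
Proof.
intros hL hs HF F0 Fs hneg hpos hu hu0 hv hv0 r hr.
destruct (C1_lipschitz F 0 s HF ltac:(lra)) as [K [hK hlip]].
destruct (nonneg_solution_regular F L s u) as [C1 [V [V1 [rV eV]]]]; auto.
destruct (nonneg_solution_regular F L s v) as [C2 [W [W1 [rW eW]]]]; auto.
rewrite eV, eW by exact hr; unfold profile; f_equal; apply Rle_antisym.
- apply (sliding_le F L s C1 C2 K V V1 W W1); auto; lra.
- apply (sliding_le F L s C2 C1 K W W1 V V1); auto; lra.
Qed.

(** * Steep negative slopes overshoot *)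

(** Beyond [T] the quartic beats the power [lambda]; on [[- T, 0]] the Lipschitz bound and [F 0 = 0]
    make everything linear. The constant in the hypothesis on [F0] is thereby replaced by a term
    vanishing at 0, which the estimates near [r = 0] require. *)
Lemma quartic_perturbation (F F0 : R -> R) (kappa lambda C : R) :
  class_C 1 (fun _ => True) F -> F 0 = 0 -> 0 < kappa -> 0 <= lambda < 4 -> 0 < C ->
  (forall t, F t = kappa * t ^ 4 + F0 t) ->
  (forall t, Rabs (F0 t) <= C * (1 + real_pow (Rabs t) lambda)) ->
  exists C', 0 < C' /\ forall t, t <= 0 ->
    Rabs (F t - kappa * t ^ 4) <= kappa * t ^ 4 / 100 - C' * t.
Proof.
intros HF hF0 hk hl hC hsplit hbound.
(* For [|t| >= T] one has [C (1 + |t|^lambda) <= 2 C |t|^lambda], and [|t|^(4 - lambda) >= X] makes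
   this at most [kappa t^4 / 100]. *)
set (X := 200 * C / kappa).
assert (hX : 0 < X) by (unfold X; apply Rdiv_lt_0_compat; lra).
set (T := Rmax 1 (Rpower X (/ (4 - lambda)))).
assert (hT1 : 1 <= T) by apply Rmax_l.
destruct (C1_lipschitz F (- T) 0 HF ltac:(lra)) as [K [hK hlip]].
assert (hT3 : 0 < T ^ 3) by (apply pow_lt; lra).
exists (K + kappa * T ^ 3); split; [nra|]; intros t ht.
assert (h4 : 0 <= t ^ 4) by (replace (t ^ 4) with ((t ^ 2) ^ 2) by ring; apply pow2_ge_0).
destruct (Rle_lt_dec (- T) t) as [h|h].
- assert (a1 := hlip t 0 ltac:(lra) ltac:(lra)).
  rewrite hF0, !Rminus_0_r, (Rabs_left1 t) in a1 by lra.
  assert (a2 : t ^ 4 <= T ^ 3 * - t).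
  { replace (t ^ 4) with ((- t) ^ 3 * - t) by ring.
    apply Rmult_le_compat_r; [lra|apply pow_incr; lra]. }
  assert (a3 : kappa * t ^ 4 <= kappa * (T ^ 3 * - t)) by (apply Rmult_le_compat_l; lra).
  apply Rabs_le_between in a1; apply Rabs_le; split; nra.
- replace (F t - kappa * t ^ 4) with (F0 t) by (rewrite hsplit; ring).
  apply Rle_trans with (1 := hbound t).
  rewrite Rabs_left by lra; unfold real_pow.
  destruct (Req_dec_T (- t) 0) as [e|_]; [lra|].
  assert (b1 : 1 <= Rpower (- t) lambda).
  { rewrite <- (Rpower_O (- t)) by lra; apply Rle_Rpower; lra. }
  assert (b2 : X <= Rpower (- t) (4 - lambda)).
  { apply Rle_trans with (Rpower (Rpower X (/ (4 - lambda))) (4 - lambda)).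
    - rewrite Rpower_mult, Rinv_l, Rpower_1 by lra; lra.
    - apply Rle_Rpower_l; [lra|]; split; [apply exp_pos|].
      apply Rle_trans with T; [apply Rmax_r|lra]. }
  assert (b3 : Rpower (- t) lambda * Rpower (- t) (4 - lambda) = t ^ 4).
  { rewrite <- Rpower_plus; replace (lambda + (4 - lambda)) with (INR 4) by (simpl; ring).
    rewrite Rpower_pow by lra; ring. }
  assert (b4 : Rpower (- t) lambda * X <= t ^ 4).
  { rewrite <- b3; apply Rmult_le_compat_l; lra. }
  assert (b5 : Rpower (- t) lambda * (200 * C) <= kappa * t ^ 4).
  { replace (200 * C) with (kappa * X) by (unfold X; field; lra); nra. }
  assert (b6 : C * (1 + Rpower (- t) lambda) <= C * (2 * Rpower (- t) lambda))
    by (apply Rmult_le_compat_l; lra).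
  assert (b7 : 0 <= (K + kappa * T ^ 3) * - t) by (apply Rmult_le_pos; nra).
  lra.
Qed.

(** Two integrations. The term [m x^6] stems from a linear part of the source, [n x^12] from the
    quartic part [x^4 (x^2 V)^4]. Lower bounds follow by applying it to [- z]. *)
Lemma flux_upper (z p g : R -> R) m n c : 0 <= c -> p 0 = 0 ->
  (forall x, 0 <= x <= c -> is_derive z x (p x) /\ is_derive (fun x => x ^ 6 * p x) x (g x)) ->
  (forall x, 0 <= x <= c -> g x <= m * x ^ 6 + n * x ^ 12) ->
  (forall x, 0 <= x <= c -> x * p x <= m / 7 * x ^ 2 + n / 13 * x ^ 8) /\
  z c <= z 0 + m / 14 * c ^ 2 + n / 104 * c ^ 8.
Proof.
intros hc p0 hd hg.
assert (hp : forall x, 0 <= x <= c -> p x <= m / 7 * x + n / 13 * x ^ 7).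
{ intros x hx; destruct (Req_dec x 0) as [->|hn]; [rewrite p0; simpl; lra|].
  assert (h : x ^ 6 * p x - (m / 7 * x ^ 7 + n / 13 * x ^ 13)
    <= 0 ^ 6 * p 0 - (m / 7 * 0 ^ 7 + n / 13 * 0 ^ 13)).
  { apply (deriv_le0_decr (fun x => x ^ 6 * p x - (m / 7 * x ^ 7 + n / 13 * x ^ 13))
      (fun x => g x - (m * x ^ 6 + n * x ^ 12))); [lra| |].
    - intros y hy; apply (is_derive_minus (V := R_NormedModule) (fun x => x ^ 6 * p x)).
      + apply hd; lra.
      + auto_derive; trivial; simpl; field.
    - intros y hy; specialize (hg y ltac:(lra)); lra. }
  rewrite !pow_ne_zero, !Rmult_0_l, !Rmult_0_r in h by easy.
  assert (h6 : 0 < x ^ 6) by (apply pow_lt; lra).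
  apply Rmult_le_reg_l with (1 := h6); lra. }
split.
- intros x hx; specialize (hp x hx).
  replace (m / 7 * x ^ 2 + n / 13 * x ^ 8) with (x * (m / 7 * x + n / 13 * x ^ 7)) by ring.
  apply Rmult_le_compat_l; lra.
- assert (h : z c - (m / 14 * c ^ 2 + n / 104 * c ^ 8) <= z 0 - (m / 14 * 0 ^ 2 + n / 104 * 0 ^ 8)).
  { apply (deriv_le0_decr (fun x => z x - (m / 14 * x ^ 2 + n / 104 * x ^ 8))
      (fun x => p x - (m / 7 * x + n / 13 * x ^ 7))); [lra| |].
    - intros y hy; apply (is_derive_minus (V := R_NormedModule)).
      + apply hd; lra.
      + auto_derive; trivial; simpl; field.
    - intros y hy; specialize (hp y hy); lra. }
  rewrite !pow_ne_zero, !Rmult_0_r in h by easy; lra.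
Qed.

Section SteepShot.
Variables (kappa C B L s A rho : R) (f V V1 : R -> R).
(** Starting from [rho], a factor of at most [exp 12] brings [theta] to [- 76 / 15], and a further
    factor 6 brings [u] above [s]. *)
Let delta := 6 * exp 12 * rho.
Hypotheses (hk : 0 < kappa) (hC : 0 < C) (hB : 0 <= B) (hL : 0 < L) (hs : 0 < s) (hA : 0 < A)
  (hrho : 0 < rho) (hdL : delta <= L) (hdC : C * delta ^ 2 <= / 1000000)
  (hds : 720 * kappa * s ^ 3 * delta ^ 2 <= 1) (hdB : 1000000 * B * delta ^ 2 <= 6 * s)
  (hArho : kappa * A ^ 3 * rho ^ 8 = 32)
  (hrad : radial f V V1) (hV0 : V 0 = - A) (hV10 : V1 0 = 0)
  (hf_mid : forall t, - (2 * A * L ^ 2) <= t <= 0 ->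
     Rabs (f t - kappa * t ^ 4) <= kappa * t ^ 4 / 100 - C * t)
  (hf_neg : forall t, t <= 0 -> C * t <= f t) (hf_pos : forall t, 0 <= t -> - B <= f t)
  (hf_s : forall t, s <= t -> f t = 0).

Let z r := - V r.
Let p r := - V1 r.
Let q r := r * p r.
Let G r := f (r ^ 2 * V r).

Lemma z_derive r : is_derive z r (p r).
Proof. apply (is_derive_opp (V := R_NormedModule)), hrad. Qed.

Lemma p_flux_derive r : is_derive (fun x => x ^ 6 * p x) r (- (r ^ 4 * G r)).
Proof.
apply (is_derive_ext (fun x => - (x ^ 6 * V1 x))).
{ intros x; unfold p; assert (h : forall a : R, - (x ^ 6 * a) = x ^ 6 * - a) by (intros; ring); apply h. }
apply (is_derive_opp (V := R_NormedModule) (fun x => x ^ 6 * V1 x)), hrad.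
Qed.

Lemma q_derive r : 0 < r -> is_derive q r ((- 5 * q r - G r) / r).
Proof.
intros hr; unfold q.
replace ((- 5 * (r * p r) - G r) / r) with (1 * p r + r * - (G r / r ^ 2 - 6 * V1 r / r))
  by (unfold p; field; lra).
apply (is_derive_mult (K := R_AbsRing) (fun x => x) p); [apply (is_derive_id (K := R_AbsRing))| |exact Rmult_comm].
apply (is_derive_opp (V := R_NormedModule)); apply (radial_derive2 f V V1 r hrad); lra.
Qed.

Lemma G_lower r : 0 <= z r -> - (C * (r ^ 2 * z r)) <= G r.
Proof.
intros hz; unfold G, z in *; assert (h2 := pow2_ge_0 r).
assert (h : r ^ 2 * V r <= 0) by nra.
specialize (hf_neg _ h); nra.
Qed.

Lemma G_approx r : 0 <= r <= delta -> 0 <= z r <= 2 * A ->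
  Rabs (G r - kappa * r ^ 8 * z r ^ 4) <= kappa * r ^ 8 * z r ^ 4 / 100 + C * (r ^ 2 * z r).
Proof.
intros hr hz; unfold G, z in *; assert (h2 := pow2_ge_0 r).
assert (h3 : r ^ 2 <= L ^ 2) by (apply pow_incr; lra).
assert (h := hf_mid (r ^ 2 * V r) ltac:(nra)).
replace ((r ^ 2 * V r) ^ 4) with (r ^ 8 * (- V r) ^ 4) in h by ring.
rewrite <- !Rmult_assoc in h; rewrite <- !Rmult_assoc; lra.
Qed.

Lemma small_r r : 0 <= r <= delta -> 0 <= C * r ^ 2 <= / 1000000.
Proof.
intros hr; assert (r ^ 2 <= delta ^ 2) by (apply pow_incr; lra).
split; [apply Rmult_le_pos; [lra|apply pow2_ge_0]|].
apply Rle_trans with (2 := hdC), Rmult_le_compat_l; lra.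
Qed.

(** While [z >= 0], only the linear error in [G] can make [z] grow, and [small_r] keeps its effect
    below one per cent. *)
Lemma z_upper R0 : 0 <= R0 <= delta -> (forall x, 0 <= x <= R0 -> 0 <= z x) ->
  forall x, 0 <= x <= R0 -> z x < 1.01 * A.
Proof.
intros hR hz x hx; apply Rnot_le_lt; intros hle.
destruct (first_zero (fun x => 1.01 * A - z x) 0 x) as [c [hc [ec hlt]]].
- lra.
- intros y _; apply (continuous_minus (V := R_NormedModule)); [apply continuous_const|].
  apply is_derive_cont with (p y), z_derive.
- unfold z; rewrite hV0; lra.
- lra.
- destruct (flux_upper z p (fun r => - (r ^ 4 * G r)) (C * (1.01 * A)) 0 c) as [_ h].
  + lra.
  + unfold p; rewrite hV10; ring.
  + intros; split; [apply z_derive|apply p_flux_derive].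
  + intros y hy; assert (h1 := G_lower y (hz y ltac:(lra))).
    assert (h2 : z y <= 1.01 * A).
    { destruct (Req_dec y c) as [->|]; [lra|]; specialize (hlt y ltac:(lra)); lra. }
    assert (h4 : 0 <= y ^ 4) by (apply pow_le; lra).
    assert (h5 : 0 <= y ^ 2) by (apply pow_le; lra).
    assert (h6 : y ^ 4 * (C * (y ^ 2 * z y)) <= y ^ 4 * (C * (y ^ 2 * (1.01 * A)))).
    { apply Rmult_le_compat_l; [lra|]; apply Rmult_le_compat_l; [lra|]; now apply Rmult_le_compat_l. }
    nra.
  + replace (z 0) with A in h by (unfold z; rewrite hV0; ring).
    assert (hs0 := small_r c ltac:(lra)); nra.
Qed.

Lemma rho_lt_delta : 12 * rho <= delta.
Proof. unfold delta; assert (h := exp_ineq1 12 ltac:(lra)); nra. Qed.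

(** The constant 1.052 exceeds [1.01 * 1.01^4]: one factor for the error in [G], four for
    [z < 1.01 A]. The terms in [C] are at most [0.001 A] by [small_r]. *)
Lemma flux_initial R0 m : 0 <= R0 <= rho -> 0 <= m -> (forall x, 0 <= x <= R0 -> m * A <= z x) ->
  (forall x, 0 <= x <= R0 -> - (0.001 * A + 1.052 / 13 * (kappa * A ^ 4) * x ^ 8) <= q x
      <= 0.001 * A - 0.99 * m ^ 4 / 13 * (kappa * A ^ 4) * x ^ 8) /\
  A - 0.001 * A - 1.052 / 104 * (kappa * A ^ 4) * R0 ^ 8 <= z R0.
Proof.
intros hR hm hz.
assert (hrd := rho_lt_delta).
assert (hz0 : forall x, 0 <= x <= R0 -> 0 <= z x).
{ intros x hx; specialize (hz x hx); assert (0 <= m * A) by nra; lra. }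
assert (hup := z_upper R0 ltac:(lra) hz0).
assert (hA4 : 0 < kappa * A ^ 4) by (apply Rmult_lt_0_compat; [lra|apply pow_lt; lra]).
assert (hGb : forall x, 0 <= x <= R0 ->
  0.99 * m ^ 4 * (kappa * A ^ 4) * x ^ 12 - 1.01 * C * A * x ^ 6 <= x ^ 4 * G x
  <= 1.052 * (kappa * A ^ 4) * x ^ 12 + 1.01 * C * A * x ^ 6).
{ intros x hx; specialize (hz x hx); specialize (hz0 x hx); specialize (hup x hx).
  assert (h : Rabs (G x - kappa * x ^ 8 * z x ^ 4)
    <= kappa * x ^ 8 * z x ^ 4 / 100 + C * (x ^ 2 * z x)) by (apply G_approx; lra).
  assert (hx4 : 0 <= x ^ 4) by (apply pow_le; lra).
  assert (hx8 : 0 <= x ^ 8) by (apply pow_le; lra).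
  assert (hx2 : 0 <= x ^ 2) by (apply pow_le; lra).
  assert (z4u : z x ^ 4 <= (1.01 * A) ^ 4) by (apply pow_incr; lra).
  assert (z4l : (m * A) ^ 4 <= z x ^ 4) by (apply pow_incr; nra).
  assert (hkx : 0 <= kappa * x ^ 8) by nra.
  assert (a1 : kappa * x ^ 8 * z x ^ 4 <= kappa * x ^ 8 * (1.01 * A) ^ 4) by now apply Rmult_le_compat_l.
  assert (a2 : kappa * x ^ 8 * (m * A) ^ 4 <= kappa * x ^ 8 * z x ^ 4) by now apply Rmult_le_compat_l.
  assert (a3 : C * (x ^ 2 * z x) <= C * (x ^ 2 * (1.01 * A))).
  { apply Rmult_le_compat_l; [lra|]; apply Rmult_le_compat_l; lra. }
  apply Rabs_le_between in h.
  assert (a4 : 0 <= kappa * A ^ 4 * x ^ 8) by nra.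
  replace (kappa * x ^ 8 * (1.01 * A) ^ 4) with (1.01 ^ 4 * (kappa * A ^ 4 * x ^ 8)) in a1 by ring.
  replace (kappa * x ^ 8 * (m * A) ^ 4) with (m ^ 4 * (kappa * A ^ 4 * x ^ 8)) in a2 by ring.
  split.
  - replace (0.99 * m ^ 4 * (kappa * A ^ 4) * x ^ 12 - 1.01 * C * A * x ^ 6)
      with (x ^ 4 * (0.99 * (m ^ 4 * (kappa * A ^ 4 * x ^ 8)) - C * (x ^ 2 * (1.01 * A)))) by ring.
    apply Rmult_le_compat_l; lra.
  - replace (1.052 * (kappa * A ^ 4) * x ^ 12 + 1.01 * C * A * x ^ 6)
      with (x ^ 4 * (1.052 * (kappa * A ^ 4 * x ^ 8) + C * (x ^ 2 * (1.01 * A)))) by ring.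
    apply Rmult_le_compat_l; lra. }
assert (p0 : p 0 = 0) by (unfold p; rewrite hV10; ring).
destruct (flux_upper z p (fun r => - (r ^ 4 * G r)) (1.01 * C * A)
  (- (0.99 * m ^ 4 * (kappa * A ^ 4))) R0) as [hU _]; [lra|exact p0| | |].
{ intros; split; [apply z_derive|apply p_flux_derive]. }
{ intros x hx; specialize (hGb x hx); lra. }
destruct (flux_upper (fun x => - z x) (fun x => - p x) (fun r => r ^ 4 * G r) (1.01 * C * A)
  (1.052 * (kappa * A ^ 4)) R0) as [hD hDz]; [lra|rewrite p0; ring| | |].
{ intros x hx; split; [apply (is_derive_opp (V := R_NormedModule)), z_derive|].
  apply (is_derive_ext (fun x => x ^ 6 * V1 x)); [|apply hrad].
  intros y; unfold p; now rewrite Ropp_involutive. }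
{ intros x hx; specialize (hGb x hx); lra. }
assert (hCx : forall x, 0 <= x <= R0 -> 0 <= 1.01 * C * A / 7 * x ^ 2 <= 0.001 * A).
{ intros x hx; assert (h := small_r x ltac:(lra)).
  replace (1.01 * C * A / 7 * x ^ 2) with (1.01 / 7 * A * (C * x ^ 2)) by field.
  nra. }
split.
- intros x hx; specialize (hU x hx); specialize (hD x hx); specialize (hCx x hx); unfold q; lra.
- specialize (hCx R0 ltac:(lra)); replace (z 0) with A in hDz by (unfold z; rewrite hV0; ring); lra.
Qed.

(** Here 32 must not be too large: the drop of [z] on [[0, rho]] is at most
    [(0.001 + 1.052 * 32 / 104) A < 0.4 A]. *)
Lemma z_initial x : 0 <= x <= rho -> 0.6 * A < z x.
Proof.
intros hx; apply Rnot_le_lt; intros hle.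
destruct (first_zero (fun x => z x - 0.6 * A) 0 x) as [c [hc [ec hlt]]].
- lra.
- intros y _; apply (continuous_minus (V := R_NormedModule)); [|apply continuous_const].
  apply is_derive_cont with (p y), z_derive.
- unfold z; rewrite hV0; lra.
- lra.
- destruct (flux_initial c 0.6 ltac:(lra) ltac:(lra)) as [_ h].
  { intros y hy; destruct (Req_dec y c) as [->|]; [lra|]; specialize (hlt y ltac:(lra)); lra. }
  assert (h8 : c ^ 8 <= rho ^ 8) by (apply pow_incr; lra).
  assert (kappa * A ^ 4 * c ^ 8 <= 32 * A).
  { rewrite <- hArho; replace (kappa * A ^ 3 * rho ^ 8 * A) with (kappa * A ^ 4 * rho ^ 8) by ring.
    apply Rmult_le_compat_l; [apply Rmult_le_pos; [lra|apply pow_le; lra]|exact h8]. }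
  lra.
Qed.

Lemma A4_rho8 c : kappa * A ^ 4 * (c * rho) ^ 8 = 32 * c ^ 8 * A.
Proof.
replace (kappa * A ^ 4 * (c * rho) ^ 8) with (kappa * A ^ 3 * rho ^ 8 * c ^ 8 * A) by ring.
rewrite hArho; ring.
Qed.

Lemma flux_initial_rho c : 0 <= c <= 1 ->
  - (0.001 + 1.052 / 13 * 32 * c ^ 8) * A <= q (c * rho)
      <= (0.001 - 0.99 * 0.6 ^ 4 / 13 * 32 * c ^ 8) * A.
Proof.
intros hc; assert (hcr : 0 <= c * rho <= rho) by nra.
destruct (flux_initial rho 0.6 ltac:(lra) ltac:(lra)) as [h _].
{ intros y hy; apply Rlt_le, z_initial, hy. }
specialize (h (c * rho) hcr).
rewrite !(Rmult_assoc _ (kappa * A ^ 4)), A4_rho8 in h; lra.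
Qed.

Lemma z_rho_upper x : 0 <= x <= rho -> z x < 1.01 * A.
Proof.
assert (hrd := rho_lt_delta); apply z_upper; [lra|].
intros y hy; assert (h := z_initial y hy); lra.
Qed.

(** The hypothesis makes [z r^(76/15)] nondecreasing, so [z] cannot vanish before [theta] has passed
    [- 76 / 15]. *)
Lemma z_persists R0 : rho <= R0 -> (forall x, rho <= x <= R0 -> 0 <= q x + 76 / 15 * z x) ->
  forall x, 0 <= x <= R0 -> 0 < z x.
Proof.
intros hR hq x hx; destruct (Rle_lt_dec x rho) as [hxr|hxr].
{ assert (h := z_initial x ltac:(lra)); lra. }
assert (h : z rho * exp (76 / 15 * ln rho) <= z x * exp (76 / 15 * ln x)).
{ apply (deriv_ge0_incr (fun y => z y * exp (76 / 15 * ln y))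
    (fun y => p y * exp (76 / 15 * ln y) + z y * (76 / 15 * / y * exp (76 / 15 * ln y)))); [lra| |].
  - intros y hy; apply (is_derive_mult (K := R_AbsRing) z (fun y => exp (76 / 15 * ln y)));
      [apply z_derive| |exact Rmult_comm].
    auto_derive; [lra|field; lra].
  - intros y hy; specialize (hq y ltac:(lra)); unfold q in hq.
    replace (p y * exp (76 / 15 * ln y) + z y * (76 / 15 * / y * exp (76 / 15 * ln y)))
      with ((y * p y + 76 / 15 * z y) * (/ y * exp (76 / 15 * ln y))) by (field; lra).
    apply Rmult_le_pos; [exact hq|].
    apply Rlt_le, Rmult_lt_0_compat; [apply Rinv_0_lt_compat; lra|apply exp_pos]. }
assert (h0 := z_initial rho ltac:(lra)).
assert (h1 := exp_pos (76 / 15 * ln rho)); assert (h2 := exp_pos (76 / 15 * ln x)).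
nra.
Qed.

(* Pohozaev quantity: for the pure power [f t = kappa t^4], [J = r^(16/3) j] satisfies
   [r J' >= J / 3]. *)
Let j r := kappa * r ^ 8 * z r ^ 5 + 5 / 2 * q r ^ 2 + 13 * q r * z r + 4 / 3 * z r ^ 2.

Let dj r := (8 * kappa * r ^ 8 * z r ^ 5 + 5 * kappa * r ^ 8 * z r ^ 4 * q r
  + (5 * q r + 13 * z r) * (- 5 * q r - G r) + 13 * q r ^ 2 + 8 / 3 * z r * q r) / r.

Lemma j_derive r : 0 < r -> is_derive j r (dj r).
Proof.
intros hr; assert (hz := z_derive r); assert (hq := q_derive r hr).
assert (hp : p r = q r / r) by (unfold q; field; lra); rewrite hp in hz.
unfold j, dj; auto_derive.
- split; [exists (q r / r); exact hz|].
  split; [exists ((- 5 * q r - G r) / r); exact hq|]; repeat split.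
  + exists ((- 5 * q r - G r) / r); exact hq.
  + exists (q r / r); exact hz.
  + exists (q r / r); exact hz.
- assert (ez : Derive (fun x => z x) r = q r / r) by exact (is_derive_unique _ _ _ hz).
  assert (eq : Derive (fun x => q x) r = (- 5 * q r - G r) / r) by exact (is_derive_unique _ _ _ hq).
  rewrite ez, eq; field; lra.
Qed.

(** Where [j] vanishes, [k] is a quadratic in [t = q / z], and [r j' / z^2] equals
    [(t + 8/3)^2 / 2 + 28/9] up to a term linear in the error [g] of [G / z]. The margin absorbs
    that term. *)
Lemma j_pos R0 : rho <= R0 <= delta -> (forall x, 0 <= x <= R0 -> 0 < z x) ->
  forall x, rho <= x <= R0 -> 0 < j x.
Proof.
intros hR hz.
assert (hup := z_upper R0 ltac:(lra) (fun x hx => Rlt_le _ _ (hz x hx))).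
assert (hb : forall x, rho / 2 <= x <= R0 -> 0 < j x).
{ apply (barrier j dj).
  - intros x hx; apply j_derive; lra.
  (* At [rho / 2] the factor [32 / 2^8 = 1 / 8] leaves [q >= - 0.02 A], so [4/3 z^2] dominates
     [13 q z]. *)
  - assert (h1 := flux_initial_rho (/ 2) ltac:(lra)).
    replace (/ 2 * rho) with (rho / 2) in h1 by field.
    assert (h2 := z_initial (rho / 2) ltac:(lra)); unfold j.
    assert (h3 : - 0.02 * A <= q (rho / 2)) by lra.
    assert (h4 : 0 <= kappa * (rho / 2) ^ 8 * z (rho / 2) ^ 5).
    { apply Rmult_le_pos; [apply Rmult_le_pos; [lra|]|]; apply pow_le; lra. }
    nra.
  - intros x hx ej _; unfold dj.
    apply Rdiv_lt_0_compat; [|lra].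
    specialize (hz x ltac:(lra)); specialize (hup x ltac:(lra)).
    assert (hG := G_approx x ltac:(lra) ltac:(lra)); assert (hC2 := small_r x ltac:(lra)).
    unfold j in ej.
    set (t := q x / z x).
    assert (et : q x = t * z x) by (unfold t; field; lra).
    set (k := kappa * x ^ 8 * z x ^ 3).
    replace (kappa * x ^ 8 * z x ^ 5) with (k * z x ^ 2) in * by (unfold k; ring).
    replace (kappa * x ^ 8 * z x ^ 4) with (k * z x) in * by (unfold k; ring).
    assert (hz2 : 0 < z x ^ 2) by (apply pow_lt; lra).
    assert (ek : k = - (5 / 2 * t ^ 2 + 13 * t + 4 / 3)).
    { apply Rmult_eq_reg_r with (z x ^ 2); [|lra]; rewrite et in ej; lra. }
    set (g := (G x - k * z x) / z x).
    assert (eG : G x = (k + g) * z x) by (unfold g; field; lra).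
    assert (hg : Rabs g <= k / 100 + C * x ^ 2).
    { unfold g, Rdiv; rewrite Rabs_mult, (Rabs_pos_eq (/ z x)) by (apply Rlt_le, Rinv_0_lt_compat; lra).
      apply Rmult_le_reg_r with (1 := hz).
      rewrite Rmult_assoc, Rinv_l, Rmult_1_r by lra; lra. }
    (* 15.6 lies just above the maximum of the quadratic, attained at [t = - 2.6]; one per cent of
       it gives [|g| <= 0.2]. *)
    assert (hk2 : k <= 15.6) by (rewrite ek; assert (h := pow2_ge_0 (t + 2.6)); nra).
    apply Rabs_le_between in hg.
    rewrite et, eG.
    replace (8 * kappa * x ^ 8 * z x ^ 5) with (8 * k * z x ^ 2) by (unfold k; ring).
    replace (5 * kappa * x ^ 8 * z x ^ 4) with (5 * k * z x) by (unfold k; ring).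
    replace (8 * k * z x ^ 2 + 5 * k * z x * (t * z x) +
      (5 * (t * z x) + 13 * z x) * (- 5 * (t * z x) - (k + g) * z x) + 13 * (t * z x) ^ 2 +
      8 / 3 * z x * (t * z x)) with
      (z x ^ 2 * (- 5 * (k + 5 / 2 * t ^ 2 + 13 * t + 4 / 3)
        + / 2 * (t + 8 / 3) ^ 2 + 28 / 9 - g * (5 * (t + 8 / 3) - / 3))) by field.
    apply Rmult_lt_0_compat; [exact hz2|].
    replace (k + 5 / 2 * t ^ 2 + 13 * t + 4 / 3) with 0 by lra.
    assert (hg2 : - 0.2 <= g <= 0.2) by lra.
    assert (hsq := pow2_ge_0 (t + 8 / 3 - 5 * g)).
    assert (hgg : g ^ 2 <= 0.2 ^ 2) by (rewrite <- !Rsqr_pow2; apply Rsqr_le_abs_1, Rabs_le;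
      rewrite Rabs_pos_eq; lra).
    lra. }
intros x hx; apply hb; lra.
Qed.

Let theta r := q r / z r.

(** A Riccati equation. Without [G] its equilibria are 0 and [- 5], the exponents of the two
    homogeneous solutions. *)
Lemma theta_derive r : 0 < r -> z r <> 0 ->
  is_derive theta r ((- 5 * theta r - theta r ^ 2 - G r / z r) / r).
Proof.
intros hr hz; unfold theta.
replace ((- 5 * (q r / z r) - (q r / z r) ^ 2 - G r / z r) / r)
  with (((- 5 * q r - G r) / r * z r - q r * p r) / z r ^ 2) by (unfold q; field; lra).
apply (is_derive_div q z); [now apply q_derive|apply z_derive|exact hz].
Qed.

Lemma delta_end : 0 < delta / 6 /\ rho <= delta / 6.
Proof. assert (h := rho_lt_delta); split; lra. Qed.

(* Below [theta = -4/15] and above [-76/15] the positivity of [j] forces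
   [r theta' < -4/10], so the second threshold is reached before [r = exp 12 * rho]. *)
Lemma theta_reaches : exists r, rho <= r <= delta / 6 /\
  (forall x, 0 <= x <= r -> 0 < z x) /\ theta r = - 76 / 15.
Proof.
assert (hde := delta_end); assert (hrd := rho_lt_delta).
set (psi := fun x => q x + 76 / 15 * z x).
(* Here 32 must not be too small: [q <= - 0.31 A] and [z < 1.01 A] put [theta] below [- 4 / 15] at
   [rho]. *)
assert (hr0 := flux_initial_rho 1 ltac:(lra)); rewrite Rmult_1_l in hr0.
assert (hz0 := z_initial rho ltac:(lra)); assert (hz1 := z_rho_upper rho ltac:(lra)).
assert (psi_c : forall x, rho <= x <= delta / 6 -> continuous psi x).
{ intros x hx; apply (continuous_plus (V := R_NormedModule)).
  - apply is_derive_cont with ((- 5 * q x - G x) / x), q_derive; lra.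
  - apply (continuous_mult (K := R_AbsRing)); [apply continuous_const|].
    apply is_derive_cont with (p x), z_derive. }
assert (psi0 : 0 < psi rho) by (unfold psi; lra).
assert (hneg : exists x, rho <= x <= delta / 6 /\ psi x <= 0).
{ apply NNPP; intros hn.
  assert (hpsi : forall x, rho <= x <= delta / 6 -> 0 < psi x).
  { intros x hx; apply Rnot_le_lt; intros h; apply hn; now exists x. }
  assert (hz := z_persists (delta / 6) ltac:(lra) (fun x hx => Rlt_le _ _ (hpsi x hx))).
  assert (hj := j_pos (delta / 6) ltac:(lra) hz).
  assert (hup := z_upper (delta / 6) ltac:(lra) (fun x hx => Rlt_le _ _ (hz x hx))).
  assert (hth : forall x, rho <= x <= delta / 6 -> - 76 / 15 < theta x).
  { intros x hx; specialize (hpsi x hx); specialize (hz x ltac:(lra)); unfold psi, theta in *.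
    apply Rmult_lt_reg_r with (z x); [exact hz|].
    replace (q x / z x * z x) with (q x) by (field; lra); lra. }
  assert (hbar : forall x, rho <= x <= delta / 6 ->
    0 < - 4 / 15 - theta x - 0.4 * (ln x - ln rho)).
  { apply (barrier _ (fun x => - ((- 5 * theta x - theta x ^ 2 - G x / z x) / x) - 0.4 * / x)).
    - intros x hx; apply (is_derive_minus (V := R_NormedModule)).
      + replace (- ((- 5 * theta x - theta x ^ 2 - G x / z x) / x))
          with (0 - (- 5 * theta x - theta x ^ 2 - G x / z x) / x) by ring.
        apply (is_derive_minus (V := R_NormedModule)); [apply (is_derive_const (V := R_NormedModule))|].
        apply theta_derive; [lra|]; specialize (hz x ltac:(lra)); lra.
      + auto_derive; [lra|field; lra].
    - rewrite Rminus_diag; unfold theta.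
      assert (q rho / z rho < - 4 / 15); [|lra].
      apply Rmult_lt_reg_r with (z rho); [lra|].
      replace (q rho / z rho * z rho) with (q rho) by (field; lra); lra.
    - intros x hx ex _.
      assert (hln : ln rho <= ln x) by (apply Rlt_le, ln_increasing; lra).
      specialize (hth x ltac:(lra)); specialize (hj x ltac:(lra)); specialize (hz x ltac:(lra)).
      specialize (hup x ltac:(lra)).
      assert (hG := G_approx x ltac:(lra) ltac:(lra)); assert (hC2 := small_r x ltac:(lra)).
      assert (hi : 0 < / x) by (apply Rinv_0_lt_compat; lra).
      replace (- ((- 5 * theta x - theta x ^ 2 - G x / z x) / x) - 0.4 * / x)
        with ((5 * theta x + theta x ^ 2 + G x / z x - 0.4) * / x) by (field; lra).
      apply Rmult_lt_0_compat; [|exact hi].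
      unfold j in hj; set (k := kappa * x ^ 8 * z x ^ 3).
      replace (kappa * x ^ 8 * z x ^ 5) with (k * z x ^ 2) in * by (unfold k; ring).
      replace (kappa * x ^ 8 * z x ^ 4) with (k * z x) in * by (unfold k; ring).
      assert (et : q x = theta x * z x) by (unfold theta; field; lra).
      rewrite et in hj.
      assert (hk3 : 0 < k + 5 / 2 * theta x ^ 2 + 13 * theta x + 4 / 3).
      { apply Rmult_lt_reg_r with (z x ^ 2); [apply pow_lt; lra|]; lra. }
      assert (hg : 0.99 * k - C * x ^ 2 <= G x / z x).
      { apply Rmult_le_reg_r with (z x); [exact hz|].
        replace (G x / z x * z x) with (G x) by (field; lra).
        apply Rabs_le_between in hG; lra. }
      assert (ht : theta x <= - 4 / 15) by lra.
      (* Without the errors, [j > 0] gives [r theta' < 3/2 (theta + 4/15) (theta + 76/15) - 52/75];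
         the excess of [52/75] over 0.4 pays for the errors in [G]. *)
      assert ((theta x + 4 / 15) * (theta x + 76 / 15) <= 0) by nra.
      nra. }
  (* The two thresholds are [72 / 15 = 0.4 * 12] apart, which is the origin of [exp 12]. *)
  specialize (hbar (delta / 6) ltac:(lra)); specialize (hth (delta / 6) ltac:(lra)).
  replace (delta / 6) with (exp 12 * rho) in hbar, hth by (unfold delta; field).
  rewrite ln_mult, ln_exp in hbar by (lra || apply exp_pos); lra. }
destruct hneg as [y [hy hpy]].
destruct (first_zero psi rho y) as [r [hr [er hlt]]]; try lra.
{ intros x hx; apply psi_c; lra. }
assert (hz := z_persists r ltac:(lra)).
exists r; split; [lra|].
assert (hzr : forall x, 0 <= x <= r -> 0 < z x).
{ apply hz; intros x hx; change (0 <= psi x).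
  destruct (Req_dec x r) as [->|]; [lra|]; apply Rlt_le, hlt; lra. }
split; [exact hzr|]; specialize (hzr r ltac:(lra)); unfold theta, psi in *.
apply Rmult_eq_reg_r with (z r); [|lra].
replace (q r / z r * z r) with (q r) by (field; lra); lra.
Qed.

(** If the flux [r^6 V'] were conserved from [theta = - 76 / 15] on, [V] would rise from [- z] to
    [(76/75 - 1) z > 0]. The source perturbs this little up to [6 r4], and vanishes once [u] is
    above [s]. *)
Lemma steep_shot_crosses : s < profile V L.
Proof.
destruct theta_reaches as [r4 [hr4 [hz eth]]].
assert (hrd := rho_lt_delta).
assert (hj := j_pos r4 ltac:(lra) hz r4 ltac:(lra)).
assert (hz4 := hz r4 ltac:(lra)); clear hz.
assert (eq4 : q r4 = - 76 / 15 * z r4).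
{ rewrite <- eth; unfold theta; field; lra. }
assert (hr2 : 0 < r4 ^ 2) by (apply pow_lt; lra).
assert (hrd2 : r4 ^ 2 <= delta ^ 2) by (apply pow_incr; lra).
(* At [theta = - 76 / 15], [j > 0] means [k > 16 / 45]. *)
assert (hk4 : 0.3 < kappa * r4 ^ 8 * z r4 ^ 3).
{ unfold j in hj; rewrite eq4 in hj.
  apply Rmult_lt_reg_r with (z r4 ^ 2); [apply pow_lt; lra|].
  assert (0 < z r4 ^ 2) by (apply pow_lt; lra); nra. }
set (w := r4 ^ 2 * z r4).
assert (hw0 : 0 < w) by (apply Rmult_lt_0_compat; lra).
(* As [k = kappa r4^2 w^3], [w <= 6 s] would give [k <= 216 / 720 = 0.3], whence the 720. The factor
   6 is what [36 * 0.005 * 6 > 1] requires at [6 r4]. *)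
assert (hw : 6 * s < w).
{ apply Rnot_le_lt; intros hle.
  assert (h3 : w ^ 3 <= (6 * s) ^ 3) by (apply pow_incr; lra).
  replace (kappa * r4 ^ 8 * z r4 ^ 3) with (r4 ^ 2 * kappa * w ^ 3) in hk4 by (unfold w; ring).
  assert (h4 : r4 ^ 2 * kappa * w ^ 3 <= delta ^ 2 * kappa * (6 * s) ^ 3).
  { apply Rmult_le_compat; [nra|apply pow_le; lra|nra|exact h3]. }
  assert (h5 := hds); lra. }
assert (hzB : 1000000 * B <= z r4).
{ apply Rmult_le_reg_l with (1 := hr2).
  assert (1000000 * B * r4 ^ 2 <= 1000000 * B * delta ^ 2) by (apply Rmult_le_compat_l; lra).
  unfold w in hw; lra. }
set (c0 := r4 ^ 5 * z r4).
assert (hr5 : 0 < r4 ^ 5) by (apply pow_lt; lra).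
assert (hc0 : 0 < c0) by (apply Rmult_lt_0_compat; lra).
assert (hV1r4 : r4 ^ 6 * V1 r4 = 76 / 15 * c0).
{ replace (r4 ^ 6 * V1 r4) with (- (r4 ^ 5 * q r4)) by (unfold q, p; ring).
  rewrite eq4; unfold c0; field. }
(* Over [[r4, 6 r4]] the source removes at most [2 / 1000000 * 6^4 * 5] times [c0], so the flux
   stays above 5.03 times [c0]. *)
assert (hP : forall x, r4 <= x <= 6 * r4 -> 5.03 * c0 < x ^ 6 * V1 x).
{ intros x hx; apply Rnot_le_lt; intros hle.
  destruct (first_zero (fun x => x ^ 6 * V1 x - 5.03 * c0) r4 x) as [c [hc [ec hlt]]]; try lra.
  { intros y _; apply (continuous_minus (V := R_NormedModule)); [|apply continuous_const].
    apply is_derive_cont with (source f V y), hrad. }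
  assert (hVy : forall y, r4 <= y <= c -> - z r4 <= V y).
  { intros y hy; replace (- z r4) with (V r4) by (unfold z; ring).
    apply (deriv_ge0_incr V V1); [lra|intros; apply hrad|]; intros t ht.
    assert (h6 : 0 < t ^ 6) by (apply pow_lt; lra).
    assert (h7 : 0 <= t ^ 6 * V1 t).
    { destruct (Req_dec t c) as [->|]; [lra|]; specialize (hlt t ltac:(lra)); lra. }
    apply Rmult_le_reg_l with (1 := h6); lra. }
  destruct (mean_value (fun x => x ^ 6 * V1 x) (source f V) r4 c ltac:(lra)) as [t [ht et]].
  { intros; apply hrad. }
  assert (hsmall := small_r t ltac:(lra)).
  assert (hft : - (2 / 1000000 * z r4) <= f (t ^ 2 * V t)).
  { specialize (hVy t ht); assert (ht2 := pow2_ge_0 t).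
    destruct (Rle_lt_dec (V t) 0) as [hn|hp].
    - assert (h := hf_neg (t ^ 2 * V t) ltac:(nra)).
      assert (- (t ^ 2 * z r4) <= t ^ 2 * V t) by nra.
      assert (C * - (t ^ 2 * z r4) <= C * (t ^ 2 * V t)) by (apply Rmult_le_compat_l; lra).
      assert (C * t ^ 2 * z r4 <= / 1000000 * z r4) by (apply Rmult_le_compat_r; lra).
      lra.
    - assert (h := hf_pos (t ^ 2 * V t) ltac:(nra)); lra. }
  assert (ht4 : 0 <= t ^ 4 <= (6 * r4) ^ 4) by (split; [apply pow_le|apply pow_incr]; lra).
  assert (hsrc : - (2 / 1000000 * 1296 * r4 ^ 4 * z r4) <= source f V t).
  { unfold source; nra. }
  assert (0 <= r4 ^ 4 * z r4) by (apply Rmult_le_pos; [apply pow_le|]; lra).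
  assert (- (2 / 1000000 * 1296 * r4 ^ 4 * z r4) * (5 * r4) <= source f V t * (c - r4)).
  { apply Rle_trans with (- (2 / 1000000 * 1296 * r4 ^ 4 * z r4) * (c - r4)).
    - nra.
    - apply Rmult_le_compat_r; lra. }
  replace (- (2 / 1000000 * 1296 * r4 ^ 4 * z r4) * (5 * r4))
    with (- (2 / 1000000 * 6480 * c0)) in H0 by (unfold c0; ring).
  lra. }
set (r6 := 6 * r4).
(* The mode has decayed by [6^5 = 7776], and [5.03 / 5 * (1 - 1 / 7776) - 1 > 0.005]. *)
assert (hV6 : 0.005 * z r4 <= V r6).
{ assert (h : V r4 + 5.03 / 5 * c0 * / r4 ^ 5 <= V r6 + 5.03 / 5 * c0 * / r6 ^ 5).
  { apply (deriv_ge0_incr (fun x => V x + 5.03 / 5 * c0 * / x ^ 5)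
      (fun x => V1 x + - (5.03 * c0) * / x ^ 6)); [unfold r6; lra| |].
    - intros x hx; apply (is_derive_plus (V := R_NormedModule)); [apply hrad|].
      auto_derive; [|field; lra].
      repeat apply Rmult_integral_contrapositive_currified; lra.
    - intros x hx; specialize (hP x ltac:(unfold r6 in hx; lra)).
      replace (V1 x + - (5.03 * c0) * / x ^ 6) with ((x ^ 6 * V1 x - 5.03 * c0) * / x ^ 6)
        by (field; lra).
      apply Rmult_le_pos; [lra|apply Rlt_le, Rinv_0_lt_compat, pow_lt; lra]. }
  replace (5.03 / 5 * c0 * / r4 ^ 5) with (5.03 / 5 * z r4) in h by (unfold c0; field; lra).
  replace (5.03 / 5 * c0 * / r6 ^ 5) with (5.03 / 5 / 7776 * z r4) in h by (unfold c0, r6; field; lra).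
  replace (V r4) with (- z r4) in h by (unfold z; ring).
  lra. }
assert (hu6 : s < profile V r6).
{ unfold profile, r6 in *; unfold w in hw; nra. }
(* A return to [s] is impossible: while [u > s] the flux keeps its positive value, so [V] and [u]
   increase. *)
apply Rnot_le_lt; intros hle.
destruct (first_zero (fun x => profile V x - s) r6 L) as [c [hc [ec hlt]]]; try lra.
{ unfold r6; lra. }
{ intros y _; apply (continuous_minus (V := R_NormedModule)); [|apply continuous_const].
  apply is_derive_cont with (profile1 V V1 y), (profile_derive f); exact hrad. }
assert (hPc : forall x, r6 <= x <= c -> r6 ^ 6 * V1 r6 <= x ^ 6 * V1 x).
{ intros x hx; apply (deriv_ge0_incr (fun x => x ^ 6 * V1 x) (source f V)); [lra|intros; apply hrad|].
  intros y hy; unfold source; rewrite hf_s; [lra|].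
  change (y ^ 2 * V y) with (profile V y).
  destruct (Req_dec y c) as [->|]; [lra|]; specialize (hlt y ltac:(lra)); lra. }
assert (hVc : V r6 <= V c).
{ apply (deriv_ge0_incr V V1); [lra|intros; apply hrad|]; intros x hx.
  specialize (hPc x hx); specialize (hP r6 ltac:(unfold r6; lra)).
  assert (h6 : 0 < x ^ 6) by (apply pow_lt; unfold r6 in hx; lra).
  apply Rmult_le_reg_l with (1 := h6); lra. }
assert (r6 ^ 2 <= c ^ 2) by (apply pow_incr; unfold r6 in *; lra).
assert (profile V r6 <= profile V c); [|lra].
unfold profile; apply Rmult_le_compat; [apply pow2_ge_0|lra|lra|lra].
Qed.

End SteepShot.

Lemma cube_root x : 0 < x -> exists y, 0 < y /\ y ^ 3 = x.
Proof.
intros hx; exists (exp (ln x / 3)); split; [apply exp_pos|].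
rewrite <- Rpower_pow by apply exp_pos; unfold Rpower; rewrite ln_exp.
replace (INR 3 * (ln x / 3)) with (ln x) by (simpl; field); now apply exp_ln.
Qed.

Lemma exists_small_square L X : 0 < L -> 0 < X -> exists d, 0 < d <= L /\ X * d ^ 2 <= 1.
Proof.
intros hL hX; set (d := Rmin L (Rmin 1 (/ X))).
assert (hi : 0 < / X) by now apply Rinv_0_lt_compat.
assert (hd : 0 < d) by (unfold d; repeat apply Rmin_pos; lra).
assert (h1 : d <= 1) by (unfold d; rewrite Rmin_r; apply Rmin_l).
assert (h2 : d <= / X) by (unfold d; rewrite !Rmin_r; lra).
exists d; repeat split; [exact hd|apply Rmin_l|].
apply Rle_trans with (X * d); [apply Rmult_le_compat_l; simpl; nra|].
replace 1 with (X * / X) by (field; lra); apply Rmult_le_compat_l; lra.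
Qed.

(** [A] precedes [f] because [F] will be truncated at a depth depending on [A]. A [delta] small
    against [C], [kappa s^3] and [B / s] determines [rho], hence [A]. *)
Lemma steep_slope_exists (kappa C B L s : R) :
  0 < kappa -> 0 < C -> 0 <= B -> 0 < L -> 0 < s ->
  exists A, 0 < A /\ forall f V V1, radial f V V1 -> V 0 = - A -> V1 0 = 0 ->
    (forall t, - (2 * A * L ^ 2) <= t <= 0 ->
       Rabs (f t - kappa * t ^ 4) <= kappa * t ^ 4 / 100 - C * t) ->
    (forall t, t <= 0 -> C * t <= f t) -> (forall t, 0 <= t -> - B <= f t) ->
    (forall t, s <= t -> f t = 0) -> s < profile V L.
Proof.
intros hk hC hB hL hs.
assert (hs3 : 0 < s ^ 3) by now apply pow_lt.
assert (hks : 0 < kappa * s ^ 3) by now apply Rmult_lt_0_compat.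
assert (hBs : 0 <= B / s) by now apply Rdiv_le_0_compat.
destruct (exists_small_square L (1000000 * C + 720 * kappa * s ^ 3 + 1000000 * (B / s)) hL)
  as [delta [hd hX]]; [lra|].
assert (hd2 : 0 < delta ^ 2) by (apply pow_lt; lra).
assert (x1 : 0 <= C * delta ^ 2) by (apply Rmult_le_pos; lra).
assert (x2 : 0 <= kappa * s ^ 3 * delta ^ 2) by (apply Rmult_le_pos; lra).
assert (x3 : 0 <= B / s * delta ^ 2) by (apply Rmult_le_pos; lra).
set (rho := delta / (6 * exp 12)).
assert (he := exp_pos 12).
assert (hrho : 0 < rho) by (apply Rdiv_lt_0_compat; lra).
assert (ed : 6 * exp 12 * rho = delta) by (unfold rho; field; lra).
assert (h8 : 0 < rho ^ 8) by now apply pow_lt.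
destruct (cube_root (32 / (kappa * rho ^ 8))) as [A [hA eA]].
{ apply Rdiv_lt_0_compat; [lra|now apply Rmult_lt_0_compat]. }
exists A; split; [exact hA|]; intros f V V1 hrad hV0 hV10 h1 h2 h3 h4.
apply (steep_shot_crosses kappa C B L s A rho f V V1); try rewrite ed; auto; try lra.
- assert (e : 1000000 * B * delta ^ 2 = 1000000 * (B / s * delta ^ 2) * s) by (field; lra).
  rewrite e; nra.
- rewrite eA; field; lra.
Qed.

(** * Existence of the sign-changing solution *)

(** A continuity argument: while [|V| <= 2 A], the argument of [f] stays in [[- 1, 1]], and the
    linear bound improves the estimate to [8/7 A]. *)
Lemma profile_bound_near_0 (f V V1 : R -> R) (A K rho : R) :
  0 < A -> 0 < K -> 0 < rho -> 2 * A * rho ^ 2 <= 1 -> K * rho ^ 2 <= 1 ->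
  radial f V V1 -> Rabs (V 0) <= A -> V1 0 = 0 ->
  (forall t, Rabs t <= 1 -> Rabs (f t) <= K * Rabs t) ->
  Rabs (V rho) <= 2 * A /\ Rabs (rho * V1 rho) <= A.
Proof.
intros hA hK hr h1 h2 H hV0 hV10 hf.
assert (key : forall c, 0 <= c <= rho -> (forall x, 0 <= x <= c -> Rabs (V x) <= 2 * A) ->
  Rabs (V c) <= 8 / 7 * A /\ Rabs (c * V1 c) <= A).
{ intros c hc hb.
  assert (hsrc : forall x, 0 <= x <= c -> Rabs (source f V x) <= K * (2 * A) * x ^ 6).
  { intros x hx; specialize (hb x hx); unfold source.
    assert (hx2 : 0 <= x ^ 2 <= rho ^ 2) by (split; [apply pow2_ge_0|apply pow_incr; lra]).
    assert (hx4 : 0 <= x ^ 4) by (apply pow_le; lra).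
    rewrite Rabs_mult, (Rabs_pos_eq (x ^ 4)) by exact hx4.
    assert (e : Rabs (x ^ 2 * V x) = x ^ 2 * Rabs (V x)) by (rewrite Rabs_mult, (Rabs_pos_eq (x ^ 2)); lra).
    assert (hxV : x ^ 2 * Rabs (V x) <= x ^ 2 * (2 * A)) by (apply Rmult_le_compat_l; lra).
    assert (hx1 : x ^ 2 * (2 * A) <= rho ^ 2 * (2 * A)) by (apply Rmult_le_compat_r; lra).
    assert (h := hf (x ^ 2 * V x) ltac:(rewrite e; lra)); rewrite e in h.
    replace (K * (2 * A) * x ^ 6) with (x ^ 4 * (K * (x ^ 2 * (2 * A)))) by ring.
    apply Rmult_le_compat_l; [exact hx4|]; apply Rle_trans with (1 := h).
    apply Rmult_le_compat_l; lra. }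
  destruct (flux_upper V V1 (source f V) (K * (2 * A)) 0 c) as [a1 a2]; [lra|exact hV10| | |].
  { intros; apply H. }
  { intros x hx; specialize (hsrc x hx); apply Rabs_le_between in hsrc; lra. }
  destruct (flux_upper (fun x => - V x) (fun x => - V1 x) (fun x => - source f V x) (K * (2 * A)) 0 c)
    as [b1 b2]; [lra|rewrite hV10; ring| | |].
  { intros x hx; split; [apply (is_derive_opp (V := R_NormedModule)), H|].
    apply (is_derive_ext (fun x => - (x ^ 6 * V1 x))).
    - intros y; assert (h : forall b : R, - (y ^ 6 * b) = y ^ 6 * - b) by (intros; ring); apply h.
    - apply (is_derive_opp (V := R_NormedModule) (fun x => x ^ 6 * V1 x)), H. }
  { intros x hx; specialize (hsrc x hx); apply Rabs_le_between in hsrc; lra. }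
  specialize (a1 c ltac:(lra)); specialize (b1 c ltac:(lra)).
  apply Rabs_le_between in hV0.
  assert (hc2 : 0 <= K * c ^ 2 <= 1).
  { split; [apply Rmult_le_pos; [lra|apply pow2_ge_0]|].
    apply Rle_trans with (2 := h2), Rmult_le_compat_l; [lra|apply pow_incr; lra]. }
  split; apply Rabs_le; nra. }
assert (hb : forall x, 0 <= x <= rho -> Rabs (V x) <= 2 * A).
{ intros x hx; apply Rnot_lt_le; intros hlt.
  destruct (first_zero (fun x => 2 * A - Rabs (V x)) 0 x) as [c [hc [ec hc2]]]; try lra.
  { intros y _; apply (continuous_minus (V := R_NormedModule)); [apply continuous_const|].
    apply (continuous_comp V Rabs); [apply (radial_continuous f V V1), H|apply continuous_Rabs]. }
  destruct (key c ltac:(lra)) as [h _]; [|lra].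
  intros y hy; destruct (Req_dec y c) as [->|]; [lra|]; specialize (hc2 y ltac:(lra)); lra. }
destruct (key rho ltac:(lra) hb); split; [apply hb|]; lra.
Qed.

(** For [x < 0] the orientation of the integral is reversed, so a lower bound on [f] yields the
    upper bound. *)
Lemma primitive_le (f : R -> R) C x : (forall t, continuous f t) ->
  (forall t, t <= 0 -> C * t <= f t) -> (forall t, 0 <= t -> f t <= C * t) ->
  RInt f 0 x <= C / 2 * x ^ 2.
Proof.
intros hc hn hp.
assert (hd : forall y, is_derive (fun x => RInt f 0 x - C / 2 * x ^ 2) y (f y - C * y)).
{ intros y; apply (is_derive_minus (V := R_NormedModule)).
  - exact (is_derive_primitive f y hc).
  - auto_derive; trivial; simpl; field. }
assert (e0 : RInt f 0 0 - C / 2 * 0 ^ 2 = 0) by (rewrite RInt_0_0; simpl; ring).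
assert (h : RInt f 0 x - C / 2 * x ^ 2 <= RInt f 0 0 - C / 2 * 0 ^ 2); [|lra].
destruct (Rle_lt_dec 0 x).
- apply (deriv_le0_decr (fun x => RInt f 0 x - C / 2 * x ^ 2) (fun y => f y - C * y)); auto.
  intros y hy; specialize (hp y ltac:(lra)); lra.
- apply (deriv_ge0_incr (fun x => RInt f 0 x - C / 2 * x ^ 2) (fun y => f y - C * y)); auto; [lra|].
  intros y hy; specialize (hn y ltac:(lra)); lra.
Qed.

(* The bound must not depend on how [f] is truncated at large negative arguments:
   only one-sided linear bounds on [f] are available there. *)
Lemma profile_uniform_bound (K C A L : R) : 0 < K -> 1 <= C -> 0 < A -> 0 < L ->
  exists M, 1 <= M /\ forall f V V1, radial f V V1 -> Rabs (V 0) <= A -> V1 0 = 0 ->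
    (forall t, continuous f t) -> (forall t, Rabs t <= 1 -> Rabs (f t) <= K * Rabs t) ->
    (forall t, t <= 0 -> C * t <= f t) -> (forall t, 0 <= t -> f t <= C * t) ->
    forall r, 0 <= r <= L -> Rabs (profile V r) <= M.
Proof.
intros hK hC hA hL.
destruct (exists_small_square L (2 * A + K) hL) as [rho [hr hX]]; [lra|].
assert (hr2 : 0 < rho ^ 2) by (apply pow_lt; lra).
assert (h1 : 2 * A * rho ^ 2 <= 1) by nra.
assert (h2 : K * rho ^ 2 <= 1) by nra.
set (c0 := 6 / rho ^ 2 + 2 * C).
set (E1 := (5 * A * L) ^ 2 / 2 + K + C).
assert (hE1 : 0 < E1) by (unfold E1; assert (h := pow2_ge_0 (5 * A * L)); lra).
assert (hM : 0 < E1 * exp (c0 * L)) by (apply Rmult_lt_0_compat; [exact hE1|apply exp_pos]).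
exists (1 + 2 * (E1 * exp (c0 * L))); split; [lra|].
intros f V V1 H hV0 hV10 hfc hf1 hfn hfp r hrL.
destruct (Rle_lt_dec r rho) as [hle|hlt].
{ destruct (Req_dec r 0) as [->|hn].
  { unfold profile; rewrite pow_ne_zero, Rmult_0_l, Rabs_R0 by easy; lra. }
  assert (hrr : r ^ 2 <= rho ^ 2) by (apply pow_incr; lra).
  destruct (profile_bound_near_0 f V V1 A K r) as [b _]; auto; try nra.
  unfold profile; rewrite Rabs_mult, (Rabs_pos_eq (r ^ 2)) by apply pow2_ge_0.
  assert (r ^ 2 * Rabs (V r) <= rho ^ 2 * (2 * A)).
  { apply Rmult_le_compat; auto; [apply pow2_ge_0|apply Rabs_pos]. }
  lra. }
set (u := profile V); set (u1 := profile1 V V1).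
(* The added [C u^2] compensates the primitive, at most [C / 2 u^2], and since [C >= 1] makes [E]
   dominate [(u'^2 + u^2) / 2]. *)
set (E := fun x => u1 x ^ 2 / 2 - RInt f 0 (u x) + C * u x ^ 2).
assert (hElow : forall x, (u1 x ^ 2 + u x ^ 2) / 2 <= E x).
{ intros x; assert (h := primitive_le f C (u x) hfc hfn hfp).
  assert (h' := pow2_ge_0 (u x)); unfold E; nra. }
assert (hE0 : E rho <= E1).
{ destruct (profile_bound_near_0 f V V1 A K rho) as [b1 b2]; auto; try lra.
  assert (hu : Rabs (u rho) <= 1).
  { unfold u, profile; rewrite Rabs_mult, (Rabs_pos_eq (rho ^ 2)) by lra.
    assert (rho ^ 2 * Rabs (V rho) <= rho ^ 2 * (2 * A)) by (apply Rmult_le_compat_l; lra); lra. }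
  assert (hu1 : Rabs (u1 rho) <= 5 * A * L).
  { unfold u1, profile1; replace (2 * rho * V rho + rho ^ 2 * V1 rho)
      with (rho * (2 * V rho + rho * V1 rho)) by ring.
    rewrite Rabs_mult, (Rabs_pos_eq rho) by lra.
    assert (Rabs (2 * V rho + rho * V1 rho) <= 5 * A).
    { apply Rle_trans with (1 := Rabs_triang _ _).
      rewrite Rabs_mult, (Rabs_pos_eq 2) by lra; lra. }
    assert (h := Rabs_pos (2 * V rho + rho * V1 rho)); nra. }
  assert (hPhi : Rabs (RInt f 0 (u rho)) <= K * Rabs (u rho)).
  { apply abs_primitive_le_const; [exact hfc|]; intros y hy.
    apply Rle_trans with (1 := hf1 y ltac:(lra)).
    rewrite <- (Rmult_1_r K) at 2; apply Rmult_le_compat_l; lra. }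
  apply Rabs_le_between in hPhi.
  assert (a1 : u1 rho ^ 2 <= (5 * A * L) ^ 2).
  { rewrite <- !Rsqr_pow2; apply Rsqr_le_abs_1; rewrite (Rabs_pos_eq (5 * A * L)); [exact hu1|].
    apply Rmult_le_pos; lra. }
  assert (a2 : u rho ^ 2 <= 1).
  { rewrite <- (pow1 2), <- !Rsqr_pow2; apply Rsqr_le_abs_1; rewrite Rabs_R1; exact hu. }
  unfold E, E1; nra. }
(* The terms in [f] cancel, so [E'] is quadratic in [u] and [u'] and Gronwall applies with the rate
   [c0]. *)
assert (hEd : forall x, rho <= x ->
  is_derive E x (u1 x * (6 * u x / x ^ 2 - 2 * u1 x / x) + 2 * C * u x * u1 x)).
{ intros x hx.
  replace (u1 x * (6 * u x / x ^ 2 - 2 * u1 x / x) + 2 * C * u x * u1 x)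
    with ((u1 x * (2 * V x - 2 * x * V1 x + f (u x)) - u1 x * f (u x)) + C * (2 * u x * u1 x))
    by (unfold u, u1, profile, profile1; field; lra).
  assert (d1 : is_derive u x (u1 x)) by apply (profile_derive f V V1 x H).
  assert (d2 : is_derive u1 x (2 * V x - 2 * x * V1 x + f (u x))).
  { apply (profile_derive2 f V V1 x H); lra. }
  apply (is_derive_plus (V := R_NormedModule)); [apply (is_derive_minus (V := R_NormedModule))|].
  - replace (u1 x * (2 * V x - 2 * x * V1 x + f (u x)))
      with ((2 * V x - 2 * x * V1 x + f (u x)) * u1 x) by ring.
    apply (is_derive_comp (V := R_NormedModule) (fun y => y ^ 2 / 2) u1); [|exact d2].
    auto_derive; trivial; simpl; field.
  - apply (is_derive_comp (V := R_NormedModule) (fun y => RInt f 0 y) u); [|exact d1].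
    now apply is_derive_primitive.
  - apply is_derive_scal; replace (2 * u x * u1 x) with (u1 x * (2 * u x)) by ring.
    apply (is_derive_comp (V := R_NormedModule) (fun y => y ^ 2) u); [|exact d1].
    auto_derive; trivial; simpl; ring. }
assert (hgr : E r * exp (- (c0 * r)) <= E rho * exp (- (c0 * rho))).
{ apply (deriv_le0_decr (fun x => E x * exp (- (c0 * x)))
    (fun x => (u1 x * (6 * u x / x ^ 2 - 2 * u1 x / x) + 2 * C * u x * u1 x) * exp (- (c0 * x))
      + E x * (- c0 * exp (- (c0 * x))))); [lra| |].
  - intros x hx; apply (is_derive_mult (K := R_AbsRing) E (fun x => exp (- (c0 * x))));
      [apply hEd; lra| |exact Rmult_comm].
    auto_derive; trivial; ring.
  - intros x hx; assert (he := exp_pos (- (c0 * x))); specialize (hElow x).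
    assert (hx2 : rho ^ 2 <= x ^ 2) by (apply pow_incr; lra).
    assert (hix : 0 < 6 / x ^ 2 <= 6 / rho ^ 2).
    { split; [apply Rdiv_lt_0_compat; lra|]; apply Rmult_le_compat_l; [lra|].
      apply Rinv_le_contravar; lra. }
    assert (hux : Rabs (u x * u1 x) <= E x).
    { apply Rle_trans with (2 := hElow), Rabs_le.
      assert (g1 := pow2_ge_0 (u1 x - u x)); assert (g2 := pow2_ge_0 (u1 x + u x)); lra. }
    assert (hd : u1 x * (6 * u x / x ^ 2 - 2 * u1 x / x) + 2 * C * u x * u1 x <= c0 * E x).
    { replace (u1 x * (6 * u x / x ^ 2 - 2 * u1 x / x) + 2 * C * u x * u1 x)
        with ((6 / x ^ 2 + 2 * C) * (u x * u1 x) - 2 * (u1 x ^ 2 * / x)) by (field; lra).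
      assert (g1 : 0 <= u1 x ^ 2 * / x).
      { apply Rmult_le_pos; [apply pow2_ge_0|apply Rlt_le, Rinv_0_lt_compat; lra]. }
      assert (g2 : (6 / x ^ 2 + 2 * C) * (u x * u1 x) <= (6 / x ^ 2 + 2 * C) * Rabs (u x * u1 x)).
      { apply Rmult_le_compat_l; [lra|apply Rle_abs]. }
      assert (g3 : (6 / x ^ 2 + 2 * C) * Rabs (u x * u1 x) <= c0 * E x).
      { apply Rmult_le_compat; [lra|apply Rabs_pos|unfold c0; lra|exact hux]. }
      lra. }
    nra. }
assert (hc0 : 0 < c0) by (unfold c0; assert (0 < 6 / rho ^ 2) by (apply Rdiv_lt_0_compat; lra); lra).
assert (e1 : exp (- (c0 * rho)) <= 1).
{ rewrite <- exp_0; apply Rlt_le, exp_increasing; nra. }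
assert (hEr : E r <= E1 * exp (c0 * L)).
{ assert (e2 : E r * exp (- (c0 * r)) <= E1).
  { apply Rle_trans with (1 := hgr); assert (g1 := exp_pos (- (c0 * rho))).
    assert (g2 := hElow rho); assert (g3 := pow2_ge_0 (u1 rho)); assert (g4 := pow2_ge_0 (u rho)).
    nra. }
  assert (e3 : exp (c0 * r) <= exp (c0 * L)).
  { destruct (Req_dec r L) as [->|]; [lra|]; apply Rlt_le, exp_increasing; nra. }
  assert (e4 : exp (- (c0 * r)) * exp (c0 * r) = 1) by (rewrite <- exp_plus, Rplus_opp_l; apply exp_0).
  assert (e5 := exp_pos (c0 * r)).
  replace (E r) with (E r * exp (- (c0 * r)) * exp (c0 * r)) by (rewrite Rmult_assoc, e4; ring).
  apply Rle_trans with (E1 * exp (c0 * r)); [apply Rmult_le_compat_r|apply Rmult_le_compat_l]; lra. }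
assert (hl := hElow r); assert (g := pow2_ge_0 (u1 r)).
fold u; apply Rabs_le; assert (g1 := pow2_ge_0 (u r - 1)); assert (g2 := pow2_ge_0 (u r + 1)).
lra.
Qed.

Lemma sign_changing_solution_exists
  (L s : R) (F F0 : R -> R) (kappa lambda C : R) :
  0 < L -> 0 < s -> class_C 1 (fun _ => True) F -> F 0 = 0 -> F s = 0 ->
  0 < kappa -> 0 <= lambda < 4 -> 0 < C ->
  (forall t, F t = kappa * t ^ 4 + F0 t) ->
  (forall t, Rabs (F0 t) <= C * (1 + real_pow (Rabs t) lambda)) ->
  exists u, is_solution F L s u /\ sign_changing_on L u.
Proof.
intros hL hs HF hF0 hFs hk hl hC hsplit hbound.
destruct (quartic_perturbation F F0 kappa lambda C) as [C1 [hC1 hquart]]; auto.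
destruct (C1_lipschitz F (- 1) s HF ltac:(lra)) as [K [hK hlip]].
set (C2 := C1 + K + 1).
destruct (steep_slope_exists kappa C2 (K * s) L s) as [A [hA hsteep]]; auto.
{ unfold C2; lra. }
{ apply Rmult_le_pos; lra. }
destruct (profile_uniform_bound K C2 A L) as [M0 [hM0 hbd]]; auto.
{ unfold C2; lra. }
(* [M0] keeps the solution found below out of the truncated range; [2 A L^2] makes the quartic
   estimate available to [hsteep]. *)
set (M := M0 + 2 * A * L ^ 2).
assert (hL2 : 0 < L ^ 2) by now apply pow_lt.
assert (hM : 1 <= M) by (unfold M; nra).
destruct (C1_lipschitz F (- M) s HF ltac:(lra)) as [K2 [hK2 hlip2]].
set (f := truncate F (- M) s).
assert (hf : lipschitz K2 f) by (apply truncate_lipschitz; lra || exact hlip2).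
assert (f_in : forall t, - M <= t <= s -> f t = F t) by (intros; now apply truncate_in).
assert (f_hi : forall t, s <= t -> f t = 0).
{ intros; unfold f; rewrite truncate_above; lra. }
assert (f_lo : forall t, t <= - M -> f t = F (- M)) by (intros; unfold f; rewrite truncate_below; lra).
assert (f0 : f 0 = 0) by (rewrite f_in; lra).
assert (hfc : forall t, continuous f t) by (intros; now apply lipschitz_continuous with K2).
assert (hFlow : forall t, t <= 0 -> C1 * t <= F t).
{ intros t ht; assert (h := hquart t ht); apply Rabs_le_between in h.
  assert (0 <= t ^ 4) by (replace (t ^ 4) with ((t ^ 2) ^ 2) by ring; apply pow2_ge_0).
  assert (0 <= kappa * t ^ 4) by (apply Rmult_le_pos; lra); lra. }
assert (f_neg : forall t, t <= 0 -> C2 * t <= f t).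
{ intros t ht; destruct (Rle_lt_dec t (- M)) as [h|h].
  - rewrite f_lo by exact h; assert (h' := hFlow (- M) ltac:(lra)); unfold C2; nra.
  - rewrite f_in by lra; assert (h' := hFlow t ht); unfold C2; nra. }
assert (f_abs : forall t, - 1 <= t -> Rabs (f t) <= K * Rabs t).
{ intros t ht; destruct (Rlt_le_dec s t) as [h|h].
  - rewrite f_hi, Rabs_R0 by lra; apply Rmult_le_pos; [lra|apply Rabs_pos].
  - rewrite f_in by lra; assert (h' := hlip t 0 ltac:(lra) ltac:(lra)).
    rewrite hF0, !Rminus_0_r in h'; exact h'. }
assert (f_pos : forall t, 0 <= t -> f t <= C2 * t).
{ intros t ht; assert (h := f_abs t ltac:(lra)); rewrite (Rabs_pos_eq t) in h by exact ht.
  apply Rabs_le_between in h; unfold C2; nra. }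
assert (f_pos' : forall t, 0 <= t -> - (K * s) <= f t).
{ intros t ht; destruct (Rlt_le_dec s t) as [h|h].
  - rewrite f_hi by lra; assert (0 <= K * s) by (apply Rmult_le_pos; lra); lra.
  - assert (h' := f_abs t ltac:(lra)); rewrite (Rabs_pos_eq t) in h' by exact ht.
    apply Rabs_le_between in h'; nra. }
assert (hrad := fun a => shoot_radial K2 f a hK2 hf f0).
assert (hend : s < profile (shoot f (- A)) L).
{ destruct (hrad (- A)) as [e H].
  apply (hsteep f _ _ H e); auto; [apply flux_0|].
  intros t ht; rewrite f_in by (unfold M; lra).
  apply Rle_trans with (1 := hquart t ltac:(lra)); unfold C2; nra. }
destruct (ivt (fun a => shoot f (- a) L) 0 A (s / L ^ 2)) as [a [ha ea]].
{ lra. }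
{ intros x; apply (continuous_comp Ropp (fun a => shoot f a L)).
  - apply (continuous_opp (V := R_NormedModule) (fun x => x)), continuous_id.
  - now apply (shoot_continuous_in_slope K2). }
{ rewrite Ropp_0, (shoot_zero K2) by assumption; split.
  - apply Rlt_le, Rdiv_lt_0_compat; lra.
  - apply (proj2 (Rle_div_l s (shoot f (- A) L) (L ^ 2) hL2)); unfold profile in hend; lra. }
assert (ha0 : 0 < a).
{ destruct (Req_dec a 0) as [->|]; [|lra].
  rewrite Ropp_0, (shoot_zero K2) in ea by assumption.
  assert (0 < s / L ^ 2) by (apply Rdiv_lt_0_compat; lra); lra. }
destruct (hrad (- a)) as [V0 H]; set (V := shoot f (- a)) in *; set (V1 := flux f V) in *.
assert (hVL : profile V L = s) by (unfold profile; rewrite ea; field; lra).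
assert (hVs := profile_le f V V1 L s hL hs H (fun t h => f_hi t (Rlt_le _ _ h)) hVL).
assert (hVM : forall r, 0 <= r <= L -> Rabs (profile V r) <= M0).
{ apply (hbd f V V1 H); auto.
  - rewrite V0, Rabs_Ropp, Rabs_pos_eq; lra.
  - apply flux_0.
  - intros t ht; apply f_abs; apply Rabs_le_between in ht; lra. }
assert (hVc : forall r, continuous V r) by (intros; now apply (radial_continuous f V V1)).
exists (profile V); split.
{ apply (radial_is_solution f F V V1); auto.
  intros r hr; apply f_in; specialize (hVM r ltac:(lra)); apply Rabs_le_between in hVM.
  split; [unfold M; nra|apply hVs; lra]. }
split.
- destruct (continuous_pos_near (fun r => - V r) 0) as [d [hd h]].
  + apply (continuous_opp (V := R_NormedModule)), hVc.
  + rewrite V0; lra.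
  + set (r := Rmin (L / 2) (d / 2)).
    assert (hr : 0 < r < L /\ r < d) by (unfold r, Rmin; destruct (Rle_dec _ _); lra).
    exists r; split; [lra|].
    specialize (h r ltac:(rewrite Rminus_0_r, Rabs_pos_eq; lra)).
    assert (0 < r ^ 2) by (apply pow_lt; lra); unfold profile; nra.
- destruct (continuous_pos_near V L (hVc L)) as [d [hd h]].
  + rewrite ea; apply Rdiv_lt_0_compat; lra.
  + set (r := Rmax (L / 2) (L - d / 2)).
    assert (hr : 0 < r < L /\ L - d < r) by (unfold r, Rmax; destruct (Rle_dec _ _); lra).
    exists r; split; [lra|].
    specialize (h r ltac:(apply Rabs_def1; lra)).
    unfold profile; apply Rmult_lt_0_compat; [apply pow_lt; lra|exact h].
Qed.

Theorem proposition5p2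
  (L s : R) (F F0 : R -> R) (kappa lambda C : R)
  (hL : 0 < L) (hs : 0 < s)
  (hF_C1 : class_C 1 (fun _ => True) F)
  (hF_0 : F 0 = 0) (hF_s : F s = 0)
  (hF_ds : 0 < Derive F s)
  (hF_neg : forall t, 0 < t < s -> F t < 0)
  (hF_nonneg : forall t, s < t -> 0 <= F t)
  (hkappa : 0 < kappa) (hlambda : 0 <= lambda < 4) (hC : 0 < C)
  (hF_split : forall t, F t = kappa * t ^ 4 + F0 t)
  (hF0 : forall t, Rabs (F0 t) <= C * (1 + real_pow (Rabs t) lambda)) :
  (exists u, is_solution F L s u /\ nonneg_on L u /\
     forall v, is_solution F L s v -> nonneg_on L v ->
       forall r, 0 < r < L -> v r = u r) /\
  (exists u, is_solution F L s u /\ sign_changing_on L u).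
Proof.
split.
- destruct (nonneg_solution_exists F L s hL hs hF_C1 hF_0 hF_s hF_neg) as [u [hu hu0]].
  exists u; split; [exact hu|split; [exact hu0|]]; intros v hv hv0.
  now apply (nonneg_solution_unique F L s).
- now apply (sign_changing_solution_exists L s F F0 kappa lambda C).
Qed.
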